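(* There exists an absolute constant $c>0$ such that for every natural number $k$, every non-bipartite 2-connected graph $G$ with average degree at least $ck$ and girth $g$ contains cycles $C_1,\dots,C_t$ with $t=k^{\lfloor (g-1)/2\rfloor}$ whose lengths are $t$ consecutive odd integers, i.e. there is an odd integer $m$ such that $|C_i|=m+2(i-1)$ for $i=1,\dots,t$.
   Context: All graphs are finite and simple. The girth of a graph is the length of its shortest cycle. A graph is 2-connected if it has at least three vertices and remains connected after deleting any single vertex. *)

(* Defs.v *)
From mathcomp Require Import all_boot all_order all_algebra.
Set Implicit Arguments. Unset Strict Implicit. Unset Printing Implicit Defensive.
Import Order.TTheory GRing.Theory Num.Theory.

Definition simple_graph (T : finType) (e : rel T) : Prop :=
  symmetric e /\ irreflexive e.

Definition is_cycle (T : finType) (e : rel T) (s : seq T) : bool :=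
  (2 < size s) && ucycleb e s.

Definition has_cycle_of_length (T : finType) (e : rel T) (L : nat) : Prop :=
  exists s : seq T, is_cycle e s /\ size s = L.

Definition girth_is (T : finType) (e : rel T) (g : nat) : Prop :=
  has_cycle_of_length e g /\
  forall s : seq T, is_cycle e s -> g <= size s.

Definition bipartite (T : finType) (e : rel T) : Prop :=
  exists f : T -> bool, forall x y, e x y -> f x != f y.

Definition del_vertex (T : finType) (e : rel T) (v : T) : rel T :=
  [rel x y | [&& e x y, x != v & y != v]].

Definition two_connected (T : finType) (e : rel T) : Prop :=
  2 < #|T| /\
  forall v x y : T, x != v -> y != v -> connect (del_vertex e v) x y.

Definition degree (T : finType) (e : rel T) (v : T) : nat := #|[set u | e v u]|.

Definition avg_degree (T : finType) (e : rel T) : rat :=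
  ((\sum_(v : T) degree e v)%:R / #|T|%:R)%R.

(* Main.v *)
Require Import Defs.
From mathcomp Require Import all_boot all_order all_algebra.
From mathcomp Require Import boolp zify.
Import Order.TTheory GRing.Theory Num.Theory.
Set Implicit Arguments. Unset Strict Implicit. Unset Printing Implicit Defensive.

(* Pass to a dense 2-connected bipartite subgraph h of G (a vertex-minimal set spanning more than
   2d(|W|-1) ordered bichromatic pairs). Since G is 2-connected and non-bipartite, some path P
   of G meets h exactly in its two ends u, v and has the wrong parity for the colouring of h,
   so it suffices to find many u-v paths in h with lengths l0, l0 + 2, l0 + 4, ...
   Take a breadth-first tree of h rooted at u. Two consecutive levels induce a dense graph, in
   which Posa rotations and the Moore bound give a cycle with a chord on at least (4k)^r
   vertices, r = (g-1)/2. Let w be the lowest common ancestor of the vertices of this cycle on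
   the upper level, and S the cycle together with the tree paths from w down to it. By an
   augmenting path argument there are disjoint paths from {u, v} to w and to some other s in S.
   Inside S, w and s are joined by paths of many lengths of equal parity: if s is on the cycle,
   follow the cycle from s and climb the tree to w; otherwise s is a tree vertex, and a cycle
   with a chord has paths of every even length from the part of the upper level below s to the
   part not below s. *)

(** * Simple paths with a prescribed vertex set *)

(* [D] is exactly the vertex set of the path, so disjointness of paths is disjointness of sets. *)
Inductive upath (T : finType) (h : rel T) : {set T} -> T -> T -> nat -> Prop :=
| upath0 (x : T) : upath h [set x] x x 0
| upathS (x y z : T) (D : {set T}) (n : nat) : h x y -> x \notin D -> upath h D y z n ->
    upath h (x |: D) x z n.+1.

Section UPath.
Variables (T : finType).
Implicit Types (h : rel T) (D B W : {set T}) (x y z : T).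

Lemma upath_start h D x y n : upath h D x y n -> x \in D.
Proof. by case=> *; rewrite ?set11 ?setU11. Qed.

Lemma upath_end h D x y n : upath h D x y n -> y \in D.
Proof. by elim=> *; rewrite ?set11 // inE; apply/orP; right. Qed.

Lemma upath_eq h D D' x y n : upath h D x y n -> D =i D' -> upath h D' x y n.
Proof. by move=> + /setP <-. Qed.

Lemma sub_upath h h' D x y n : subrel h h' -> upath h D x y n -> upath h' D x y n.
Proof. by move=> s; elim=> [?|? ? ? ? ? /s ? ? _ ?]; [left|apply: upathS; eauto]. Qed.

Lemma upath_card h D x y n : upath h D x y n -> #|D| = n.+1.
Proof.
by elim=> [?|? ? ? ? ? _ nx _ E]; rewrite ?cards1 // cardsU1 nx E.
Qed.

Lemma upath_sub h W D x y n :
  (forall a b, h a b -> (a \in W) && (b \in W)) ->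
  upath h D x y n -> x \in W -> D \subset W.
Proof.
move=> hW; elim=> [a|a b c E m hab _ _ IH] aW; first by rewrite sub1set.
by rewrite subUset sub1set aW IH //; case/andP: (hW _ _ hab).
Qed.

Lemma upath_parity h (f : T -> bool) D x y n :
  (forall a b, h a b -> f a != f b) ->
  upath h D x y n -> odd n = (f x != f y).
Proof.
move=> hf; elim=> [a|a b c E m hab _ _ IH] /=; first by rewrite eqxx.
by rewrite IH; move: (hf _ _ hab); case: (f a) (f b) (f c) => [] [] [].
Qed.

Lemma upath_cat h D1 D2 x y z m n :
  upath h D1 x y m -> upath h D2 y z n -> {in D1 & D2, forall a b, a = b -> a = y} ->
  upath h (D1 :|: D2) x z (m + n).
Proof.
elim=> [a|a b c D k hab aD P IH] Q dis.
  apply: (upath_eq Q) => t; rewrite !inE; case: eqVneq => // ->.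
  exact: upath_start Q.
rewrite -setUA; apply: (upathS hab); last first.
  by apply: IH Q _ => s t sD tD st; apply: dis st => //; rewrite inE sD orbT.
rewrite inE negb_or aD; apply/negP => aD2.
have ac : a = c by apply: (dis a a) => //; rewrite setU11.
by move: aD; rewrite ac (upath_end P).
Qed.

Lemma upath_join h D1 D2 x y z w m n :
  upath h D1 x y m -> h y z -> upath h D2 z w n -> [disjoint D1 & D2] ->
  upath h (D1 :|: D2) x w (m + n).+1.
Proof.
move=> P hyz Q dis; rewrite -addnS.
have yD2 : y \notin D2 by rewrite (disjointFr dis) // (upath_end P).
apply: upath_eq (upath_cat P (upathS hyz yD2 Q) _) _.
  move=> a b aD1; rewrite !inE => /orP[/eqP -> //|bD2] ab.
  by move: bD2; rewrite -ab (disjointFr dis).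
move=> t; rewrite !inE; case: (eqVneq t y) => // ->.
by rewrite (upath_end P).
Qed.

Lemma upath_rev h D x y n : symmetric h -> upath h D x y n -> upath h D y x n.
Proof.
move=> sh; elim=> [a|a b c E m hab aE P IH]; first by left.
rewrite setUC -[m]addn0; apply: (upath_join IH _ (upath0 h a)); first by rewrite sh.
by rewrite disjoint_sym disjoints1.
Qed.

Lemma upath_split h D x y n t : upath h D x y n -> t \in D ->
  exists D1 D2 n1 n2, [/\ upath h D1 x t n1, upath h D2 t y n2, D = D1 :|: D2,
    forall a, a \in D1 -> a \in D2 -> a = t & n = n1 + n2].
Proof.
elim=> [a|a b c E m hab aE P IH].
  rewrite inE => /eqP ->; exists [set a], [set a], 0, 0.
  by split; rewrite ?setUid //; try left; move=> ?; rewrite inE => /eqP.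
case: (eqVneq t a) => [-> _|ta].
  exists [set a], (a |: E), 0, m.+1; split=> //; try left.
  - exact: upathS hab aE P.
  - by rewrite setUA setUid.
  - by move=> ?; rewrite inE => /eqP.
rewrite !inE (negbTE ta) => /IH[D1 [D2 [n1 [n2 [P1 P2 DE I ->]]]]].
exists (a |: D1), D2, n1.+1, n2; split=> //.
- by apply: upathS hab _ P1; apply: contra aE; rewrite DE inE => ->.
- by rewrite DE setUA.
move=> d; rewrite !inE => /orP[/eqP ->|] dD; last exact: I.
by case/negP: aE; rewrite DE inE dD orbT.
Qed.

(** The path is cut at its first vertex in [B]. *)
Lemma upath_hit h D x y n B : upath h D x y n -> y \in B ->
  exists b D' n', [/\ upath h D' x b n', D' \subset D, b \in B &
    forall a, a \in D' -> a \in B -> a = b].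
Proof.
elim=> [a|a b c E m hab aE P IH] yB.
  exists a, [set a], 0; split=> //; try left.
  by move=> ?; rewrite inE => /eqP.
have [aB|aB] := boolP (a \in B).
  exists a, [set a], 0; split=> //; try left; rewrite ?sub1set ?setU11 //.
  by move=> ?; rewrite inE => /eqP.
have [b' [D' [n' [P' sD bB I]]]] := IH yB.
exists b', (a |: D'), n'.+1; split=> //.
- by apply: upathS hab _ P'; apply: contra aE => /(subsetP sD).
- exact: setUS.
move=> d; rewrite !inE => /orP[/eqP -> aB'|]; last exact: I.
by rewrite aB' in aB.
Qed.

Lemma path_upath h x p : path h x p -> uniq (x :: p) ->
  upath h [set z in x :: p] x (last x p) (size p).
Proof.
elim: p x => [|y p IH] x /=.
  by move=> _ _; apply: upath_eq (upath0 h x) _ => t; rewrite !inE.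
case/andP=> hxy hp /andP[nx up].
apply: upath_eq (upathS hxy _ (IH y hp up)) _; rewrite ?inE //.
by move=> t; rewrite !inE.
Qed.

Lemma connect_upath h x y : connect h x y -> exists D n, upath h D x y n.
Proof.
case/connectP => p hp ->; case/shortenP: hp => p' hp' up' _.
by exists [set z in x :: p'], (size p'); apply: path_upath.
Qed.

Lemma connect_avoid (R h : rel T) x y z :
  (forall a b, R a b -> [&& h a b, a != x & b != x]) -> y != x -> connect R y z ->
  exists D n, upath h D y z n /\ x \notin D.
Proof.
move=> RP yx /connect_upath[D [n PD]].
exists D, n; split; first by apply: sub_upath PD => a b /RP/and3P[].
have : D \subset [set~ x].
  apply: upath_sub PD _ => [a b /RP/and3P[_ ax bx]|]; by rewrite !inE ?ax.
by move=> /subsetP sD; apply/negP => /sD; rewrite !inE eqxx.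
Qed.

Lemma upath_path h D x y n : upath h D x y n ->
  exists p, [/\ path h x p, last x p = y, uniq (x :: p), size p = n & D =i x :: p].
Proof.
elim=> [a|a b c E m hab aE P [p [hp lp up sp DE]]].
  by exists [::]; split=> // t; rewrite !inE.
exists (b :: p); split=> //=; rewrite ?hab ?sp //.
  by rewrite -DE aE; move: up.
by move=> t; rewrite in_setU1 DE !inE.
Qed.

(** The bound [2 < m + n] rules out that both paths are one and the same edge. *)
Lemma upath_cycle h D1 D2 x y m n :
  upath h D1 x y m -> upath h D2 y x n ->
  (forall a, a \in D1 -> a \in D2 -> (a == x) || (a == y)) ->
  x != y -> 2 < m + n -> has_cycle_of_length h (m + n).
Proof.
move=> /upath_path[p [hp lp up sp Ep]] /upath_path[q [hq lq uq sq Eq]] I xy mn.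
case: (lastP q) hq lq uq sq Eq => [|q' z]; first by move=> _ /= E; rewrite E eqxx in xy.
rewrite last_rcons => + zx; rewrite {z}zx => hq uq sq Eq.
exists (x :: p ++ q'); split; last first.
  by rewrite /= size_cat -sp -sq size_rcons; lia.
rewrite /is_cycle; apply/andP; split.
  by rewrite /= size_cat -ltnS; move: mn; rewrite -sp -sq size_rcons; lia.
apply/andP; split.
  by rewrite /cycle -cats1 -catA cats1 cat_path hp lp.
rewrite -cat_cons cat_uniq up /=.
move: uq; rewrite cons_uniq rcons_uniq => /andP[yq /andP[xq ->]].
rewrite andbT; apply/hasPn => a aq; apply/negP => ap.
have := I a; rewrite Ep Eq ap in_cons mem_rcons in_cons aq !orbT => /(_ isT isT).
case/orP => /eqP E; first by rewrite -E aq in xq.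
by move: yq; rewrite mem_rcons in_cons -E aq orbT.
Qed.

End UPath.

(** * Two disjoint paths with a prescribed end *)

Section TwoPaths.
Variables (T : finType) (h : rel T) (W : {set T}).
Hypothesis sym_h : symmetric h.
Hypothesis edge_W : forall a b, h a b -> (a \in W) && (b \in W).
Hypothesis conn_h : forall x y z, x \in W -> y \in W -> z \in W ->
  y != x -> z != x -> exists D n, upath h D y z n /\ x \notin D.

(** Which of the two vertices of [A] is joined to [w] is left open, because rerouting may exchange
    them. *)
Definition two_linked (A B : {set T}) w : Prop :=
  exists a b y D1 D2 n1 n2,
    [/\ upath h D1 a w n1, upath h D2 b y n2,
        [disjoint D1 & D2], y \in B & [set a; b] = A] /\
    [/\ y != w, forall t, t \in D1 -> t \in B -> t = w &
        forall t, t \in D2 -> t \in B -> t = y].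

(* Augmentation by induction on the complement of [B]: a path [R] from {u, v} to [B] avoiding [w]
   either avoids [Q], or has a last vertex [x] on [Q]; in the latter case enlarge [B] by the parts
   of [Q] and [R] after [x], and reroute along them afterwards. *)
Lemma two_linkedP (u v w b0 : T) (B Q : {set T}) n :
  u \in W -> v \in W -> u != v -> B \subset W -> w \in B -> b0 \in B -> b0 != w ->
  upath h Q u w n -> (forall t, t \in Q -> t \in B -> t = w) ->
  two_linked [set u; v] B w.
Proof.
move=> uW vW uv; move: {2}#|W :\: B|.+1 (ltnSn #|W :\: B|) => N.
elim: N => // N IH in B w b0 Q n *.
move=> ltN BW wB b0B b0w PQ QB.
have wW := subsetP BW _ wB.
have [a0 [a0A a0w a0v]] : exists a0, [/\ a0 \in [set u; v], a0 != w & a0 = v \/ a0 = u].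
  have [vw|vw] := eqVneq v w; [exists u|exists v]; rewrite !inE eqxx ?orbT;
    by split=> //; rewrite -?vw //; auto.
have a0W : a0 \in W by case: a0v => ->.
have [R0 [n0 [PR0 wR0]]] := conn_h wW a0W (subsetP BW _ b0B) a0w b0w.
have [s [R [n1 [PR sR sB RB]]]] := upath_hit PR0 b0B.
have wR : w \notin R by apply: contra wR0 => /(subsetP sR).
have sw : s != w by apply: contraNneq wR => <-; exact: upath_end PR.
(* [Q] contains [u], so a path [R] disjoint from [Q] starts at [v]. *)
have [dQR|] := boolP [disjoint Q & R].
  exists u, v, s, Q, R, n, n1; split; split=> //.
  case: a0v => E; first by rewrite -E.
  move: dQR => /disjointFr /(_ (upath_start PQ)).
  by rewrite -E (upath_start PR).
case/pred0Pn => t0 /andP[/= t0Q t0R].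
have [R1 [R2 [m1 [m2 [_ PR2 ER _ _]]]]] := upath_split PR t0R.
(* Following [R] backwards from [s], the first vertex on [Q] is the required [x]; [xR] is the
   stretch from [s] to [x]. *)
have [x [xR [mx [PxR sxR xQ xRQ]]]] := upath_hit (upath_rev sym_h PR2) t0Q.
have {}sxR : xR \subset R by apply: (subset_trans sxR); rewrite ER subsetUr.
have [Q1 [Q2 [q1 [q2 [PQ1 PQ2 EQ IQ _]]]]] := upath_split PQ xQ.
have xxR := upath_end PxR.
have xw : x != w by apply: contraNneq wR => <-; apply: (subsetP sxR).
have xB : x \notin B by apply: contra xw => xB; apply/eqP/QB.
have Q2Q : Q2 \subset Q by rewrite EQ subsetUr.
have Q1Q : Q1 \subset Q by rewrite EQ subsetUl.
have QW := upath_sub edge_W PQ uW.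
have RW := upath_sub edge_W PR a0W.
pose B' := B :|: (Q2 :|: xR).
have xB' : x \in B' by rewrite !inE xxR !orbT.
have BB' t : t \in B -> t \in B' by rewrite inE => ->.
have QB' t : t \in Q2 -> t \in B' by rewrite !inE => ->; rewrite orbT.
have RB' t : t \in xR -> t \in B' by rewrite !inE => ->; rewrite !orbT.
have B'W : B' \subset W.
  rewrite !subUset BW (subset_trans Q2Q QW) (subset_trans sxR RW) //.
have dQ1 t : t \in Q1 -> t \in B' -> t = x.
  move=> tQ1; rewrite !inE => /orP[tB|/orP[tQ2|tR]]; last 2 first.
  - exact: IQ.
  - by apply: xRQ => //; apply: (subsetP Q1Q).
  have tw : t = w by apply: QB => //; apply: (subsetP Q1Q).
  by apply: IQ => //; rewrite tw; exact: upath_end PQ2.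
have ltB' : #|W :\: B'| < N.
  rewrite ltnS in ltN; apply: leq_trans (proper_card _) ltN; apply/properP; split.
    by apply: setDS; rewrite subsetUl.
  by exists x; rewrite in_setD ?xB' // xB (subsetP QW).
have wB' := BB' _ wB.
(* For the target [x], [D1] can be prolonged to [w] along [Q2] or to [s] along [xR]. If [y] lies on
   [Q2], [D2] continues to [w] and [D1] to [s]; if [y] lies on [xR], [D1] continues to [w] and [D2]
   to [s]; otherwise [D2] already ends in [B] and [D1] continues to [w]. *)
have [a [b [y [D1 [D2 [m1' [m2' [[P1 P2 D12 yB' Eab] [yx I1 I2]]]]]]]]] :=
  IH B' x w Q1 q1 ltB' B'W xB' wB' ltac:(by rewrite eq_sym) PQ1 dQ1.
have nD12 t : t \in D1 -> t \in D2 -> False.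
  by move=> t1; rewrite (disjointFr D12).
have xwR t : t \in xR -> t \in Q2 -> t = x.
  by move=> tR tQ; apply: xRQ => //; apply: (subsetP Q2Q).
have D1B t : t \in D1 -> t \in B -> False.
  by move=> t1 tB; move: xB; rewrite -(I1 t t1 (BB' _ tB)) tB.
have Q2B t : t \in Q2 -> t \in B -> t = w.
  by move=> tQ; apply: QB; apply: (subsetP Q2Q).
have xRB t : t \in xR -> t \in B -> t = s.
  by move=> tR; apply: RB; apply: (subsetP sxR).
have xD2 : x \notin D2 by apply/negP => x2; move: yx; rewrite -(I2 x) ?eqxx.
have P1Q : upath h (D1 :|: Q2) a w (m1' + q2).
  by apply: upath_cat P1 PQ2 _ => c d c1 d2 E; rewrite (I1 c) //; apply: QB'; rewrite E.
have P1R : upath h (D1 :|: xR) a s (m1' + mx).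
  apply: upath_cat P1 (upath_rev sym_h PxR) _ => c d c1 d2 E.
  by rewrite (I1 c) //; apply: RB'; rewrite E.
have [yQ|yQ] := boolP (y \in Q2).
  have [Y1 [Y2 [k1 [k2 [PY1 PY EY IY _]]]]] := upath_split PQ2 yQ.
  have YQ t : t \in Y2 -> t \in Q2 by rewrite EY inE orbC => ->.
  have xY : x \notin Y2.
    apply/negP => xY; move: yx; rewrite (IY x) ?eqxx //.
    exact: upath_start PY1.
  exists b, a, s, (D2 :|: Y2), (D1 :|: xR), (m2' + k2), (m1' + mx).
  split; split=> //.
  - apply: upath_cat P2 PY _ => c d c1 d2 E.
    by rewrite (I2 c) //; apply: QB'; rewrite E; apply: YQ.
  - apply/pred0P => t /=; rewrite !inE; apply/negbTE/negP.
    case/andP=> /orP[tD|tY] /orP[tD1|tR].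
    + exact: nD12 tD1 tD.
    + have E := I2 t tD (RB' t tR).
      by move: yx; rewrite (xwR y) ?eqxx // -E.
    + by move: xY; rewrite -(I1 t) ?tY //; apply/QB'/YQ.
    + by move: xY; rewrite -(xwR t) ?tY //; apply: YQ.
  - by rewrite setUC.
  - move=> t; rewrite inE => /orP[tD tB|tY]; last by apply: Q2B; apply: YQ.
    by have E := I2 _ tD (BB' _ tB); apply: Q2B => //; rewrite E.
  - move=> t; rewrite inE => /orP[tD tB|]; last exact: xRB.
    by case: (D1B t).
have [yR|yR] := boolP (y \in xR).
  have [Y2 [Y1 [k2 [k1 [PY PY1 EY IY _]]]]] := upath_split PxR yR.
  have YR t : t \in Y2 -> t \in xR by rewrite EY inE => ->.
  have xY : x \notin Y2.
    apply/negP => xY; move: yx; rewrite (IY x) ?eqxx //.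
    exact: upath_end PY1.
  exists a, b, s, (D1 :|: Q2), (D2 :|: Y2), (m1' + q2), (m2' + k2).
  split; split=> //.
  - apply: upath_cat P2 (upath_rev sym_h PY) _ => c d c1 d2 E.
    by rewrite (I2 c) //; apply: RB'; rewrite E; apply: YR.
  - apply/pred0P => t /=; rewrite !inE; apply/negbTE/negP.
    case/andP=> /orP[tD|tQ] /orP[tD2|tY].
    + exact: nD12 tD tD2.
    + by move: xY; rewrite -(I1 t) ?tY //; apply/RB'/YR.
    + by move: yQ; rewrite -(I2 t) ?tQ //; apply/QB'.
    + by move: xY; rewrite -(xwR t) ?tY //; apply: YR.
  - move=> t; rewrite inE => /orP[tD tB|]; last exact: Q2B.
    by case: (D1B t).
  - move=> t; rewrite inE => /orP[tD tB|tY]; last by apply: xRB; apply: YR.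
    by have E := I2 _ tD (BB' _ tB); apply: xRB => //; rewrite E.
have yB : y \in B by move: yB'; rewrite !inE (negbTE yQ) (negbTE yR) !orbF.
exists a, b, y, (D1 :|: Q2), D2, (m1' + q2), m2'.
split; split=> //.
- apply/pred0P => t /=; rewrite !inE; apply/negbTE/negP.
  case/andP=> /orP[tD|tQ] tD2; first exact: nD12 tD tD2.
  by move: yQ; rewrite -(I2 t) ?tQ //; apply/QB'.
- by apply: contraNneq yQ => ->; exact: upath_end PQ2.
- move=> t; rewrite inE => /orP[tD tB|]; last exact: Q2B.
  by case: (D1B t).
- by move=> t tD tB; apply: I2 => //; apply: BB'.
Qed.
End TwoPaths.

(** * Two-colourings of a cycle with a chord *)

Section Periodic.
Local Open Scope ring_scope.
Implicit Types (j a b : int).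

(** Moves an integer, modulo a period, into the window of indices where a hypothesis about paths
    applies. *)
Lemma residue_in_interval (p lo : nat) (a : int) : (0 < p)%N ->
  exists (x : nat) (k : int), (lo <= x < lo + p)%N /\ x%:Z = a + k * p%:Z.
Proof.
move=> p0; have := divz_eq (a - lo%:Z) p.
have := modz_ge0 (a - lo%:Z) (_ : p%:Z != 0).
have := ltz_pmod (a - lo%:Z) (_ : 0 < p%:Z).
move=> /(_ ltac:(lia)) l1 /(_ ltac:(lia)) l2 E.
set d := ((a - lo%:Z) %/ p)%Z in E *.
exists (absz (a - d * p%:Z)%R), (- d).
by rewrite mulNr; lia.
Qed.

(** The remainder of a period modulo the least period is again a period unless it is 0, so the least
    one divides all others. *)
Lemma minimal_period (n : nat) (chi : int -> bool) : (0 < n)%N ->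
  (forall j, chi (j + n%:Z) = chi j) ->
  exists p : nat, [/\ (0 < p)%N, forall j k, chi (j + k * p%:Z) = chi j &
    forall q : nat, (0 < q)%N -> (forall j, chi (j + q%:Z) = chi j) ->
       (p <= q)%N /\ exists c : nat, (q = c * p)%N].
Proof.
move=> n0 pn.
pose per q := (0 < q)%N && `[< forall j, chi (j + q%:Z) = chi j >].
have ex : exists q, per q by exists n; rewrite /per n0; apply/asboolP.
have [p /andP[p0 /asboolP pp] pmin] := ex_minnP ex.
have ppk (k : nat) j : chi (j + k%:Z * p%:Z) = chi j.
  elim: k j => [|k IH] j; first by rewrite mul0r addr0.
  by rewrite -[RHS]IH -[RHS]pp; congr chi; rewrite -addn1 PoszD mulrDl mul1r addrA.
have ppz (k : int) j : chi (j + k * p%:Z) = chi j.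
  case: k => k; first exact: ppk.
  by rewrite -[LHS](ppk k.+1); congr chi; rewrite NegzE mulNr subrK.
exists p; split=> // q q0 pq; split; first by apply: pmin; rewrite /per q0; apply/asboolP.
exists (q %/ p)%N; rewrite {1}(divn_eq q p).
have [->|r0] := posnP (q %% p)%N; first by rewrite addn0.
suff /pmin : per (q %% p)%N by rewrite leqNgt ltn_pmod.
rewrite /per r0; apply/asboolP => j.
rewrite -[RHS]pq -[LHS](ppz (q %/ p)%N); congr chi.
by have := f_equal Posz (divn_eq q p); rewrite PoszD PoszM; lia.
Qed.

(* [chi] colours the vertices of a cycle of length [n] with a chord from 0 to [m]. The hypotheses
   say that no path of length [l], along the cycle or through the chord in one of the four
   possible ways, joins different colours. With [p] the least period of [chi], [p > m] would make
   [m - 1] a period, and symmetrically for [n - m]; otherwise [chi] is invariant under the two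
   reflections [j -> m + 1 - j] and [j -> m - 1 - j]. *)
Lemma cycle_chord_coloring (n m l : nat) (chi : int -> bool) :
  (0 < l < n)%N -> (1 < m)%N -> (m + 1 < n)%N ->
  (forall j, chi (j + n%:Z) = chi j) ->
  (forall j, chi (j + l%:Z) = chi j) ->
  (forall a b : nat, (a + b).+1 = l -> (a + m < n)%N -> (b < m)%N ->
     chi (- a%:Z) = chi (m%:Z - b%:Z)) ->
  (forall a b : nat, (a + b).+1 = l -> (a < m)%N -> (b + m < n)%N ->
     chi a%:Z = chi (m%:Z + b%:Z)) ->
  (forall a b : nat, (a + b).+1 = l -> (a + b + m < n)%N ->
     chi (- a%:Z) = chi (m%:Z + b%:Z)) ->
  (forall a b : nat, (a + b).+1 = l -> (a + b < m)%N ->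
     chi a%:Z = chi (m%:Z - b%:Z)) ->
  forall j, chi (j + 2) = chi j.
Proof.
move=> /andP[l0 ln] m1 mn pn pl H1 H2 H3 H4.
have [p [p0 pp pmin]] := minimal_period (ltn_trans l0 ln) pn.
have [p_le_l [cl El]] := pmin _ l0 pl.
have nl0 : (0 < n - l)%N by rewrite subn_gt0.
have pnl j : chi (j + (n - l)%:Z) = chi j.
  by rewrite -pl -[RHS]pn; congr chi; lia.
have [p_le_nl _] := pmin _ nl0 pnl.
have [_ [cn En]] := pmin _ (ltn_trans l0 ln) pn.
have chiE (x y k : int) : x = y + k * p%:Z -> chi x = chi y by move=> ->; exact: pp.
(* If [m < p], then [p <= l] and [p <= n - l] make the third path hypothesis available for every
   [a < p]. As [p] divides [l], it says that [m - 1] is a period, which is smaller than [p]. *)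
have pmn : (p <= m)%N.
  rewrite leqNgt; apply/negP => mp.
  have := pmin (m - 1)%N; case; first lia; last by lia.
  move=> j; have [a [k [ak Ea]]] := residue_in_interval 0 (- j) p0.
  have := H3 a (l - 1 - a)%N ltac:(lia) ltac:(lia).
  rewrite (chiE (- a%:Z) j (- k)); last lia.
  move=> ->; rewrite [RHS](chiE _ (j + (m - 1)%N%:Z) (cl%:Z - k)) //.
  by rewrite mulrBl -PoszM -El; lia.
have pmn' : (p <= n - m)%N.
  rewrite leqNgt; apply/negP => mp.
  have := pmin (n - m - 1)%N; case; first lia; last by lia.
  move=> j; have [a [k [ak Ea]]] := residue_in_interval 0 (j + (n - m - 1)%N%:Z) p0.
  have := H4 a (l - 1 - a)%N ltac:(lia) ltac:(lia).
  rewrite (chiE a%:Z (j + (n - m - 1)%N%:Z) k); last lia.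
  move=> ->; apply: (chiE _ _ (k - cl%:Z + cn%:Z)).
  by rewrite mulrDl mulrBl -!PoszM -El -En; lia.
(* The window starts at [l - m], truncated at 0, so that [b = l - 1 - a] is less than [m]; its
   length [p] is at most [m], [n - m], [l] and [n - l], which gives the other bounds. The window for
   [R2] arises by exchanging [m] and [n - m]. *)
have R1 (a0 : int) : chi (- a0) = chi (m%:Z + 1 + a0).
  have [a [k [ak Ea]]] := residue_in_interval (l - m) a0 p0.
  have := H1 a (l - 1 - a)%N ltac:(lia) ltac:(lia) ltac:(lia).
  rewrite (chiE (- a%:Z) (- a0) (- k)); last lia.
  move=> ->; apply: (chiE _ _ (k - cl%:Z)).
  by rewrite mulrBl -PoszM -El; lia.
have R2 (a0 : int) : chi a0 = chi (m%:Z - 1 - a0).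
  have [a [k [ak Ea]]] := residue_in_interval (l + m - n) a0 p0.
  have := H2 a (l - 1 - a)%N ltac:(lia) ltac:(lia) ltac:(lia).
  rewrite (chiE a%:Z a0 k); last lia.
  move=> ->; apply: (chiE _ _ (cl%:Z - k)).
  by rewrite mulrBl -PoszM -El; lia.
by move=> j; rewrite [RHS]R2 -[j + 2]opprK R1; congr chi; lia.
Qed.
End Periodic.

(** * Paths in a cycle with a chord *)

Section CycleIndex.
Local Open Scope int_scope.
Local Open Scope nat_scope.
Variables (T : finType) (h : rel T) (x0 : T) (c : seq T).
Hypotheses (cyc_c : cycle h c) (uniq_c : uniq c) (c_gt0 : 0 < size c).

Definition cnth (i : nat) : T := nth x0 c (i %% size c).
Definition cycle_arc (i l : nat) : {set T} := [set z in map cnth (iota i l.+1)].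

Lemma cnth_mem i : cnth i \in c.
Proof. by rewrite mem_nth // ltn_pmod. Qed.

Lemma mem_arc i l z : z \in cycle_arc i l -> exists2 j, i <= j <= i + l & z = cnth j.
Proof.
rewrite inE => /mapP[j]; rewrite mem_iota => jil ->.
by exists j => //; move: jil; rewrite addnS ltnS.
Qed.

Lemma arc_sub i l : {subset cycle_arc i l <= c}.
Proof. by move=> z /mem_arc[j _ ->]; apply: cnth_mem. Qed.

Lemma cnth_edge i : h (cnth i) (cnth i.+1).
Proof.
rewrite /cnth; case: c cyc_c c_gt0 => // x p /= hp _.
have ltk : i %% (size p).+1 < size (rcons p x) by rewrite size_rcons ltn_pmod.
have := (pathP x0 hp) _ ltk; rewrite -rcons_cons nth_rcons ltn_pmod //=.
suff -> : nth x0 (rcons p x) (i %% (size p).+1) = nth x0 (x :: p) (i.+1 %% (size p).+1) by [].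
move: ltk; rewrite size_rcons ltnS leq_eqVlt => /orP[/eqP E|lt].
  by rewrite -[i.+1]addn1 -modnDml E addn1 modnn nth_rcons ltnn eqxx.
have -> : i.+1 %% (size p).+1 = (i %% (size p).+1).+1.
  by rewrite -[i.+1]addn1 -modnDml addn1 [LHS]modn_small ?ltnS.
by rewrite nth_rcons lt.
Qed.

(** The window of indices may start at any [k], which also covers arcs ending at index [size c]. *)
Lemma cnth_inj k i j : k <= i < k + size c -> k <= j < k + size c ->
  cnth i = cnth j -> i = j.
Proof.
move=> ik jk /eqP; rewrite nth_uniq ?ltn_pmod //.
wlog ij : i j ik jk / i <= j.
  move=> H E; case: (leqP i j) => ij; first exact: H.
  by apply/esym/H; rewrite // 1?eq_sym // ltnW.
rewrite eq_sym eqn_mod_dvd // => /dvdn_leq; lia.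
Qed.

Lemma cnthD i : cnth (i + size c) = cnth i.
Proof. by rewrite /cnth modnDr. Qed.

Lemma arc_upath i l : l < size c -> upath h (cycle_arc i l) (cnth i) (cnth (i + l)) l.
Proof.
elim: l i => [|l IH] i ls.
  by rewrite addn0; apply: upath_eq (upath0 h _) _ => z; rewrite !inE.
have := IH i.+1 (ltnW ls); rewrite addSnnS => P.
apply: upath_eq (upathS (cnth_edge i) _ P) _; last by move=> z; rewrite !inE.
apply/negP => /mem_arc[j ij /(@cnth_inj i)]; lia.
Qed.

Lemma arc_disjoint k i l i' l' : k <= i -> i + l < k + size c ->
  k <= i' -> i' + l' < k + size c -> (i + l < i') || (i' + l' < i) ->
  [disjoint cycle_arc i l & cycle_arc i' l'].
Proof.
move=> ki il ki' il' dis; apply/pred0P => z /=; apply/negbTE/negP.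
by case/andP=> /mem_arc[j ij ->] /mem_arc[j' ij' /(@cnth_inj k)]; lia.
Qed.

Variables (sym_h : symmetric h) (m : nat).
Hypotheses (m_gt1 : 1 < m) (m_ltn : m + 1 < size c) (chord : h (cnth 0) (cnth m)).

(** If no path of length [l] on the vertices of [c] leaves [A], then [A], read periodically along
    the cycle, is a colouring as in [cycle_chord_coloring], and hence invariant under shifts by
    2. *)
Lemma theta_upath (A : pred T) l : 0 < l < size c ->
  (exists D x y, [/\ upath h D x y l, A x, ~~ A y & {subset D <= c}]) \/
  (forall j, A (cnth (j + 2)) = A (cnth j)).
Proof.
move=> /andP[l0 ln].
case: (EM (exists D x y, [/\ upath h D x y l, A x, ~~ A y & {subset D <= c}])).
  by left.
move=> noAB; right.
have AE x y D : upath h D x y l -> {subset D <= c} -> A x = A y.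
  move=> P sD; apply/idP/idP => AA; apply/negPn/negP => nA; apply: noAB.
    by exists D, x, y.
  by exists D, y, x; split=> //; apply: upath_rev.
pose chi (j : int) := A (cnth (absz (j %% (size c)%:Z)%Z)).
have chiN (j : nat) : chi j%:Z = A (cnth j).
  by rewrite /chi modz_nat absz_nat /cnth modn_mod.
have chiD (j : int) : chi (j + (size c)%:Z)%R = chi j by rewrite /chi modzDr.
have chiV (j : nat) : j < size c -> chi (- j%:Z)%R = A (cnth (size c - j)).
  by move=> jn; rewrite -chiD -chiN; congr chi; lia.
have subU i k i' k' : {subset cycle_arc i k :|: cycle_arc i' k' <= c}.
  by move=> z; rewrite inE => /orP[] /arc_sub.
(* The end 0 of the chord is also index [size c]; arcs through negative indices are handled as arcs
   ending there. *)
have chord' : h (cnth (size c)) (cnth m) by rewrite -[size c]add0n cnthD.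
have backarc i k : k <= i -> k < size c ->
    upath h (cycle_arc (i - k) k) (cnth i) (cnth (i - k)) k.
  move=> ki kn; apply: upath_rev => //.
  by have := arc_upath (i - k) kn; rewrite subnK.
have startarc k : k < size c -> upath h (cycle_arc 0 k) (cnth k) (cnth 0) k.
  by move=> kn; have := backarc k k (leqnn k) kn; rewrite subnn.
have endarc k : k < size c ->
    upath h (cycle_arc (size c - k) k) (cnth (size c - k)) (cnth (size c)) k.
  by move=> kn; have := arc_upath (size c - k) kn; rewrite subnK // ltnW.
have chi2 : forall j : int, chi (j + 2)%R = chi j.
  apply: (@cycle_chord_coloring (size c) m l) => //; first by rewrite l0.
  - move=> j; set k := absz (j %% (size c)%:Z)%Z.
    have Ek : k%:Z = (j %% (size c)%:Z)%Z by rewrite gez0_abs // modz_ge0 //; lia.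
    have -> : chi (j + l%:Z)%R = chi (k + l)%N%:Z by rewrite /chi PoszD Ek modzDml.
    rewrite chiN; apply/esym; apply: AE (arc_upath k ln) (@arc_sub _ _).
  - move=> a b Eab am bm; rewrite chiV; last by lia.
    have -> : (m%:Z - b%:Z)%R = (m - b)%N%:Z by lia.
    rewrite chiN; apply: AE (subU _ _ _ _); rewrite -Eab.
    apply: (upath_join (endarc a _) chord' (backarc m b _ _)); try lia.
    by apply: (@arc_disjoint 1); lia.
  - move=> a b Eab am bm; rewrite -PoszD !chiN; apply: AE (subU _ _ _ _); rewrite -Eab.
    apply: (upath_join (startarc a _) chord (arc_upath m _)); try lia.
    by apply: (@arc_disjoint 0); lia.
  - move=> a b Eab am; rewrite -PoszD chiV ?chiN; last by lia.
    apply: AE (subU _ _ _ _); rewrite -Eab.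
    apply: (upath_join (endarc a _) chord' (arc_upath m _)); try lia.
    by apply: (@arc_disjoint 1); lia.
  - move=> a b Eab am.
    have -> : (m%:Z - b%:Z)%R = (m - b)%N%:Z by lia.
    rewrite !chiN; apply: AE (subU _ _ _ _); rewrite -Eab.
    apply: (upath_join (startarc a _) chord (backarc m b _ _)); try lia.
    by apply: (@arc_disjoint 0); lia.
by move=> j; rewrite -!chiN PoszD; exact: chi2.
Qed.

End CycleIndex.

(** * The Moore bound *)

Section Moore.
Variables (T : finType) (h : rel T).
Hypotheses (sym_h : symmetric h) (irr_h : irreflexive h).

(** Up to the first vertex where the path from [y1] meets the path from [y2], the two paths are
    disjoint, and [z] closes them to a cycle. *)
Lemma fork_cycle (D1 D2 : {set T}) x y1 y2 z m n :
  upath h D1 y1 x m -> upath h D2 y2 x n -> y1 != y2 -> h z y1 -> h z y2 ->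
  z \notin D1 -> z \notin D2 ->
  exists s, is_cycle h s /\ size s <= m + n + 2.
Proof.
move=> P1 P2 y12 h1 h2 z1 z2.
have [t [E1 [k1 [Q1 sE1 t2 I]]]] := upath_hit P1 (upath_end P2).
have [E2 [E3 [k2 [k3 [Q2 _ ED2 _ _]]]]] := upath_split P2 t2.
have sE2 : E2 \subset D2 by rewrite ED2 subsetUl.
have zE1 : z \notin E1 by apply: contra z1 => /(subsetP sE1).
have zE2 : z \notin E2 by apply: contra z2 => /(subsetP sE2).
have := upath_cycle (upathS h1 zE1 Q1) (upath_rev sym_h (upathS h2 zE2 Q2)).
case.
- move=> a; rewrite !inE => /orP[->//|a1] /orP[->//|a2].
  by rewrite (I a) ?eqxx ?orbT // (subsetP sE2).
- by apply: contraNneq zE1 => ->; exact: upath_end Q1.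
- rewrite addSn addnS !ltnS lt0n addn_eq0; apply: contra y12 => /andP[/eqP k10 /eqP k20].
  by move: Q1 Q2; rewrite k10 k20 => Q1 Q2; inversion Q1; inversion Q2; subst.
move=> s [cs ss]; exists s; split=> //; rewrite ss.
have := subset_leq_card sE1; have := subset_leq_card sE2.
by rewrite (upath_card P1) (upath_card P2) (upath_card Q1) (upath_card Q2); lia.
Qed.

(** Count the ends of paths of length [j] from a fixed vertex. Two distinct ends cannot both be
    extended to the same vertex, since [fork_cycle] would give a cycle of length at most [2 * r];
    and each end has at least [q] extensions, because at most one of its neighbours lies on the
    path. *)
Lemma moore_bound (V : {set T}) q r :
  V != set0 -> (forall x, x \in V -> q < #|[set y in V | h x y]|) ->
  (forall s, is_cycle h s -> r.*2 < size s) -> q ^ r <= #|V|.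
Proof.
move=> /set0Pn[x xV] degV girth.
pose N j := [set y | `[< exists D : {set T}, upath h D y x j /\ D \subset V >]].
pose Ext j y := [set z in V | h z y &
  `[< exists D : {set T}, [/\ upath h D y x j, D \subset V & z \notin D] >]].
have NV j : N j \subset V.
  apply/subsetP => y; rewrite inE => /asboolP[D [P /subsetP]]; apply.
  exact: upath_start P.
suff H j : j <= r -> q ^ j <= #|N j|.
  by apply: leq_trans (H r (leqnn r)) _; apply: subset_leq_card.
elim: j => [_|j IH jr].
  rewrite expn0 card_gt0; apply/set0Pn; exists x; rewrite inE; apply/asboolP.
  by exists [set x]; split; [left | rewrite sub1set].
have disE y y' : y != y' -> [disjoint Ext j y & Ext j y'].
  move=> yy'; apply/pred0P => z /=; apply/negbTE/negP; rewrite !inE.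
  case/andP=> /and3P[_ h1 /asboolP[D1 [P1 _ z1]]] /and3P[_ h2 /asboolP[D2 [P2 _ z2]]].
  have [s [/girth]] := fork_cycle P1 P2 yy' h1 h2 z1 z2; lia.
have cardE y : y \in N j -> q <= #|Ext j y|.
  rewrite inE => /asboolP[D [P DV]].
  have yV : y \in V by apply: (subsetP DV); exact: upath_start P.
  have := degV y yV; rewrite -(cardsID D) => degy.
  have : #|[set y0 in V | h y y0] :&: D| <= 1.
    case: P (jr) DV degy yV => [a|a b c E k hab aE P] jr' DV degy yV.
      rewrite -(cards1 a); apply/subset_leq_card/subsetP => z.
      by rewrite !inE => /andP[/andP[_ ha] /eqP E]; rewrite E irr_h in ha.
    rewrite -(cards1 b); apply/subset_leq_card/subsetP => z.
    rewrite !inE => /andP[/andP[_ hz] /orP[/eqP E1|zE]]; first by rewrite E1 irr_h in hz.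
    apply/negPn/negP => zb.
    have [E1 [E2 [k1 [k2 [Q1 Q2 EE _ Ek]]]]] := upath_split P zE.
    have sE1 : E1 \subset E by rewrite EE subsetUl.
    have aE1 : a \notin E1 by apply: contra aE => /(subsetP sE1).
    have za : z != a by apply: contraNneq aE => <-.
    have hza : upath h (z |: [set a]) z a 1.
      by apply: upathS (upath0 h a); rewrite ?inE // sym_h.
    have k10 : 0 < k1.
      by rewrite lt0n; apply: contra zb => /eqP E0; move: Q1; rewrite E0 => Q1; inversion Q1.
    have := upath_cycle (upathS hab aE1 Q1) hza; case.
    - by move=> t _; rewrite !inE orbC.
    - by rewrite eq_sym.
    - by lia.
    by move=> s [/girth + E3]; rewrite E3; lia.
  move=> I1.
  have qle : q <= #|[set y0 in V | h y y0] :\: D|.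
    by lia.
  apply: leq_trans qle _.
  apply/subset_leq_card/subsetP => z; rewrite !inE => /and3P[zD -> hyz].
  by rewrite sym_h hyz; apply/asboolP; exists D.
have sub : \bigcup_y Ext j y \subset N j.+1.
  apply/bigcupsP => y _; apply/subsetP => z; rewrite !inE.
  case/and3P=> zV hzy /asboolP[D [P DV zD]]; apply/asboolP; exists (z |: D).
  by split; [exact: upathS hzy zD P | rewrite subUset sub1set zV].
apply: leq_trans (subset_leq_card sub).
rewrite -sum1_card partition_disjoint_bigcup //.
apply: (@leq_trans (\sum_(y in N j) q)).
  by rewrite sum_nat_const expnSr leq_mul2r IH ?orbT // ltnW.
rewrite [X in _ <= X](bigID (mem (N j))) /= -[X in X <= _]addn0 leq_add //.
by apply: leq_sum => y /cardE; rewrite sum1_card.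
Qed.

End Moore.

(** * Posa rotations *)

Section Adjacent.
Variable T : eqType.
Implicit Types (s A B : seq T) (u v x y : T).

Definition link x y u v := ((u == x) && (v == y)) || ((u == y) && (v == x)).

Fixpoint adj s u v : bool :=
  if s is x :: s' then (if s' is y :: _ then link x y u v else false) || adj s' u v
  else false.

Lemma linkC x y u v : link x y u v = link y x u v.
Proof. by rewrite /link orbC. Qed.

Lemma adj_cat A B x y u v :
  adj (rcons A x ++ y :: B) u v = [|| adj (rcons A x) u v, link x y u v | adj (y :: B) u v].
Proof.
elim: A => [|a A IH] //; rewrite rcons_cons cat_cons [LHS]/= IH [adj (a :: _) _ _]/=.
by case: A {IH} => [|b A] /=; rewrite ?orbF -!orbA.
Qed.

Lemma adj_rev s u v : adj (rev s) u v = adj s u v.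
Proof.
elim: s => // a [|b s] // IH; rewrite rev_cons -cats1 rev_cons adj_cat -rev_cons IH.
by rewrite linkC orbF orbC.
Qed.

Lemma adj_nth s u v : uniq s -> adj s u v ->
  v = nth u s (index u s).+1 \/ v = nth u s (index u s).-1.
Proof.
move=> us auv.
suff [i [/andP[i1 i2]]] : exists i, 0 < i < size s /\
    ((u = nth u s i.-1 /\ v = nth u s i) \/ (u = nth u s i /\ v = nth u s i.-1)).
  case=> [[Eu Ev]|[Eu Ev]]; [left|right].
    by rewrite {2}Eu index_uniq // ?prednK //; lia.
  by rewrite {2}Eu index_uniq.
elim: s auv {us} => // a [|b s] // IH /orP[|/IH].
  case/orP=> /andP[/eqP -> /eqP ->]; exists 1; split=> //; by [left|right].
case=> i [/andP[i1 i2] H]; exists i.+1; split=> //=.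
by case: i i1 H i2.
Qed.

(** Used for a rotation at [y]: the part of the path from [w] on lies behind the reversed segment
    and stays in place. *)
Lemma cat_cons_suffix A B P S y w : A ++ y :: B = P ++ w :: S -> y \notin S ->
  exists P', y :: B = P' ++ w :: S.
Proof.
elim: A P => [|a A IH] [|b P] /=; last by case=> _; apply: IH.
- by move=> E _; exists [::].
- by move=> E _; exists (b :: P).
by case=> _ <-; rewrite mem_cat mem_head orbT.
Qed.

End Adjacent.

Section Posa.
Variables (T : finType) (h : rel T).
Hypotheses (sym_h : symmetric h) (irr_h : irreflexive h).

(** A rotation moves the head of the path: the edge from [x] to [y] replaces the path edge entering
    [y], and the last vertex stays fixed. *)
Inductive rotated (s0 : seq T) : seq T -> Prop :=
| rotated0 : rotated s0 s0
| rotatedS x A y B : rotated s0 ((x :: A) ++ y :: B) -> h x y ->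
    rotated s0 (rev (x :: A) ++ y :: B).

Lemma rotated_perm s0 s : rotated s0 s -> perm_eq s s0.
Proof.
elim=> // x A y B _ IH _; apply: perm_trans IH.
by rewrite perm_cat2r; apply/permPl/perm_rev.
Qed.

Lemma rotated_sorted s0 s : rotated s0 s -> sorted h s0 -> sorted h s.
Proof.
move=> R s0s; elim: R => // x A y B _ + hxy.
rewrite !sorted_cat_cons => /andP[+ ->]; rewrite andbT.
rewrite -rev_cons rev_sorted /= hxy rcons_path => /andP[+ _].
by apply: sub_path => a b; rewrite sym_h.
Qed.

Definition rot_heads s0 : {set T} := [set x | `[< exists s, rotated s0 (x :: s) >]].

Lemma rotated_headP s0 x A y B : rotated s0 ((x :: A) ++ y :: B) -> h x y ->
  last x A \in rot_heads s0.
Proof.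
move=> R hxy; rewrite inE; apply/asboolP; have := rotatedS R hxy.
rewrite lastI rev_rcons cat_cons.
by exists (rev (belast x A) ++ y :: B).
Qed.

(* Rotations only create and destroy edges that have an end in [rot_heads], so the
   neighbours of [y] on the path never change if none of them is in [rot_heads]. *)
Lemma posa_neighbour s0 x y : uniq s0 ->
  (forall s z, rotated s0 (x :: s) -> h x z -> z \in x :: s) ->
  x \in rot_heads s0 -> h x y -> y \notin rot_heads s0 ->
  exists2 z, z \in rot_heads s0 & adj s0 z y.
Proof.
move=> us0 maxs; rewrite {1}inE => /asboolP[s R] hxy yX.
apply: contrapT => noz.
have noadj z : z \in rot_heads s0 -> adj s0 z y -> False.
  by move=> zX za; apply: noz; exists z.
have inv s' : rotated s0 s' -> forall z, adj s' z y -> adj s0 z y.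
  elim=> // x' A y' B R' IH hxy' z.
  have lX := rotated_headP R' hxy'.
  have xX' : x' \in rot_heads s0 by rewrite inE; apply/asboolP; eexists; exact: R'.
  have xy' : x' != y by apply: contraNneq yX => <-.
  have zl : y' = y -> False.
    move=> E; apply: (noadj _ lX); apply: IH.
    by rewrite lastI adj_cat E /link !eqxx orbT.
  move: (IH z); rewrite rev_cons lastI !adj_cat -rev_cons adj_rev -lastI => {}IH.
  case/or3P=> [a1|/orP[]/andP[/eqP Ez /eqP Ey]|a3].
  - by apply: IH; rewrite a1.
  - by case: zl.
  - by rewrite Ey eqxx in xy'.
  - by apply: IH; rewrite a3 !orbT.
(* Rotating along the edge from [x] to [y] makes the predecessor of [y] a head; by [inv] it is
   adjacent to [y] already on [s0]. *)
have := maxs _ _ R hxy; rewrite inE => /orP[/eqP E|ys]; first by rewrite E irr_h in hxy.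
case/splitPr: ys R => A B R.
have lX := rotated_headP (R : rotated s0 ((x :: A) ++ y :: B)) hxy.
apply: (noadj _ lX); apply: inv R _ _.
by rewrite -cat_cons lastI adj_cat /link !eqxx orbT.
Qed.

Lemma longest_path (V : {set T}) : V != set0 ->
  exists x p, [/\ sorted h (x :: p), uniq (x :: p), {subset x :: p <= V} &
    forall y q, sorted h (y :: q) -> uniq (y :: q) -> {subset y :: q <= V} ->
      size q <= size p].
Proof.
case/set0Pn => v vV.
pose P n := `[< exists x p, [/\ sorted h (x :: p), uniq (x :: p), {subset x :: p <= V} &
  size p = n] >].
have exP : exists n, P n.
  exists 0; apply/asboolP; exists v, [::]; split=> // z.
  by rewrite inE => /eqP ->.
have ubP n : P n -> n <= #|T|.
  case/asboolP => x [p [_ up _ <-]]; apply: ltnW.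
  by have := max_card (mem (x :: p)); rewrite (card_uniqP up).
case: (ex_maxnP exP ubP) => n /asboolP[x [p [sp up pV <-]]] nmax.
exists x, p; split=> // y q sq uq qV.
by apply: nmax; apply/asboolP; exists y, q.
Qed.

Definition nbrs (X : {set T}) : {set T} := [set y | [exists x in X, h x y]].

(* Let [w] be the vertex of [nbrs X] farthest along the longest path: all rotations leave the part
   of the path behind [w] unchanged, so closing a rotated path at [w] gives a cycle through
   [X] and [nbrs X]. *)
Lemma long_chorded_cycle (V : {set T}) : V != set0 ->
  (forall a b, h a b -> (a \in V) && (b \in V)) ->
  (forall x, x \in V -> 2 < #|[set y | h x y]|) ->
  exists (X : {set T}) x0 c m,
    [/\ cycle h c, uniq c, X != set0, X \subset V & {subset X :|: nbrs X <= c}] /\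
    [/\ #|X :|: nbrs X| <= 3 * #|X|, 1 < m, m + 1 < size c &
        h (nth x0 c 0) (nth x0 c m)].
Proof.
move=> V0 hV degV.
have [x0 [p [sp up pV pmax]]] := longest_path V0.
pose s0 := x0 :: p; pose X := rot_heads s0.
have perm0 s : rotated s0 s -> perm_eq s s0 by exact: rotated_perm.
have mem0 s : rotated s0 s -> s =i s0 by move=> /perm0/perm_mem.
have uniq0 s : rotated s0 s -> uniq s by move=> /perm0/perm_uniq ->.
have sorted0 s : rotated s0 s -> sorted h s by move=> /rotated_sorted; apply.
have maxs x s z : rotated s0 (x :: s) -> h x z -> z \in x :: s.
  move=> R hxz; apply/negPn/negP => zs.
  have : size (x :: s) <= size p.
    apply: (pmax z); first 1 last.
    - by rewrite cons_uniq zs (uniq0 _ R).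
    - move=> t; rewrite in_cons => /orP[/eqP ->|]; first by case/andP: (hV _ _ hxz).
      by rewrite (mem0 _ R); apply: pV.
    by rewrite /= sym_h hxz; have := sorted0 _ R.
  by have := perm_size (perm0 _ R) => /= ->; rewrite ltnn.
have x0X : x0 \in X by rewrite inE; apply/asboolP; exists p; left.
have XP x : x \in X -> exists s, rotated s0 (x :: s) by rewrite inE => /asboolP.
have X_s0 x : x \in X -> x \in s0.
  by move=> /XP[s R]; rewrite -(mem0 _ R) mem_head.
have N_s0 y : y \in nbrs X -> y \in s0.
  rewrite inE => /existsP[x /andP[/XP[s R] hxy]]; rewrite -(mem0 _ R).
  exact: maxs R hxy.
have [y0 hx0] : exists y0, h x0 y0.
  have := degV x0 (pV _ (mem_head _ _)); case: (set_0Vmem [set y | h x0 y]) => [->|].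
    by rewrite cards0.
  by case=> y; rewrite inE => h0 _; exists y.
have y0N : y0 \in nbrs X by rewrite inE; apply/existsP; exists x0; rewrite x0X.
case: (@arg_maxnP _ y0 (mem (nbrs X)) (index^~ s0) y0N) => w wN wmax.
have := N_s0 w wN; move Es0 : (s0) => s0' ws.
case/splitPr: ws Es0 => pre suf Es0.
have us0 : uniq (pre ++ w :: suf) by rewrite -Es0.
have Nsuf y : y \in nbrs X -> y \notin suf.
  move=> yN; apply/negP => ysuf; have := wmax y yN; rewrite Es0.
  move: us0; rewrite cat_uniq => /and3P[_ /hasPn dis /= /andP[wsuf _]].
  have ypre : y \notin pre by apply: dis; rewrite in_cons ysuf orbT.
  have wpre : w \notin pre by apply: dis; rewrite mem_head.
  rewrite !index_cat (negbTE ypre) (negbTE wpre) /= eqxx.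
  by case: eqP => [E|_]; [rewrite E ysuf in wsuf | rewrite leq_add2l].
have suffix s : rotated s0 s -> exists P, s = P ++ w :: suf.
  elim=> [|x A y B R [P E] hxy]; first by exists pre.
  have yN : y \in nbrs X.
    rewrite inE; apply/existsP; exists x; rewrite hxy andbT inE; apply/asboolP.
    by exists (A ++ y :: B).
  have [P' ->] := cat_cons_suffix E (Nsuf _ yN).
  by exists (rev (x :: A) ++ P'); rewrite catA.
have Xsuf x : x \in X -> x \notin suf.
  move=> /XP[s R]; have [[|a P] E] := suffix _ R.
    by case: E => -> _; apply: Nsuf.
  case: E => _ Es; move: (uniq0 _ R) => /= /andP[+ _].
  by rewrite Es mem_cat in_cons !negb_or => /and3P[].
move: (wN : w \in nbrs X); rewrite inE => /existsP[x /andP[xX hxw]].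
have [s R] := XP x xX.
have [[|a P] E] := suffix _ R; first by case: E hxw => -> _; rewrite irr_h.
case: E => Ea Es; subst a s.
pose c := x :: rcons P w.
have mem_c z : z \in s0 -> z \notin suf -> z \in c.
  rewrite -(mem0 _ R) !in_cons mem_rcons mem_cat !in_cons => /or4P[->|->|->|->] //;
  by rewrite ?orbT.
have uc : uniq c.
  by have := uniq0 _ R; rewrite -cat_rcons -cat_cons cat_uniq => /andP[].
have cc : cycle h c.
  have := sorted0 _ R; rewrite /c /= -cat_rcons cat_path => /andP[hp _].
  by rewrite rcons_path hp last_rcons sym_h.
have Dc : {subset X :|: nbrs X <= c}.
  move=> z; rewrite inE => /orP[zX|zN]; apply: mem_c; auto.
have NxN y : h x y -> y \in nbrs X.
  by move=> hxy; rewrite inE; apply/existsP; exists x; rewrite xX.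
(* All neighbours of [x] lie on [c], and there are at least three, so one of them is neither the
   second nor the last vertex of [c]. *)
have [m [m1 m2 hm]] : exists m, [/\ 1 < m, m + 1 < size c & h x (nth x c m)].
  apply: contrapT => nom.
  have := degV x (pV _ (X_s0 _ xX)); rewrite ltnNge => /negP; apply.
  apply: (@leq_trans #|[set nth x c 1; nth x c (size c).-1]|); last first.
    by rewrite cards2; case: eqP.
  apply/subset_leq_card/subsetP => y; rewrite inE => hxy.
  have yc : y \in c by apply: Dc; rewrite inE NxN ?orbT.
  have lti : index y c < size c by rewrite index_mem.
  have Ey : nth x c (index y c) = y by rewrite nth_index.
  have i0 : index y c <> 0.
    by move=> E; move: Ey; rewrite E /= => E'; rewrite E' irr_h in hxy.
  have [i1|i1] := eqVneq (index y c) 1; first by rewrite !inE -Ey i1 eqxx.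
  have [i2|i2] := eqVneq (index y c) (size c).-1; first by rewrite !inE -Ey i2 eqxx orbT.
  have l1 : 1 < index y c by case: (index y c) i0 i1 => [|[|]].
  have l2 : index y c + 1 < size c.
    rewrite addn1 ltn_neqAle lti andbT; apply: contraNneq i2 => E.
    by rewrite -E.
  by case: nom; exists (index y c); rewrite Ey.
exists X, x, c, m; split; split=> //.
- by apply/set0Pn; exists x.
- by apply/subsetP => z /X_s0; apply: pV.
(* The factor 3: by [posa_neighbour], a vertex of [nbrs X] outside [X] is the successor or the
   predecessor on [s0] of a vertex of [X]. *)
pose f1 z := nth z s0 (index z s0).+1; pose f2 z := nth z s0 (index z s0).-1.
apply: (@leq_trans #|X :|: (f1 @: X :|: f2 @: X)|).
  apply/subset_leq_card/subsetP => y; rewrite !in_setU => /orP[->//|yN].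
  have [//|yX] := boolP (y \in X).
  move: yN; rewrite inE => /existsP[x1 /andP[x1X hx1]].
  have [z zX za] := posa_neighbour up (fun s z => @maxs x1 s z) x1X hx1 yX.
  have [->|->] := adj_nth up za; apply/orP; right; apply/orP;
    [left; exact: (imset_f f1 zX)|right; exact: (imset_f f2 zX)].
rewrite mulSn mul2n -addnn.
apply: leq_trans (leq_card_setU _ _).1 _; rewrite leq_add2l.
apply: leq_trans (leq_card_setU _ _).1 _; exact: leq_add (leq_imset_card _ _) (leq_imset_card _ _).
Qed.

End Posa.

(** * Edge counting and long chorded cycles *)

Section Volume.
Variable T : finType.
Implicit Types (h : rel T) (V W : {set T}).

(* Counts ordered pairs, i.e. every edge twice. *)
Definition vol h V : nat := \sum_x \sum_y [&& x \in V, y \in V & h x y].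
Definition restr h V : rel T := [rel x y | [&& x \in V, y \in V & h x y]].
Definition deg_in h V x : nat := #|[set y in V | h x y]|.

Lemma sum_deg_in h V x : \sum_y ((y \in V) && h x y : nat) = deg_in h V x.
Proof. by rewrite /deg_in -sum1dep_card [RHS]big_mkcond; apply: eq_bigr => y _; case: ifP. Qed.

Lemma vol_deg h V : vol h V = \sum_(x in V) deg_in h V x.
Proof.
rewrite [RHS]big_mkcond; apply: eq_bigr => x _; rewrite -sum_deg_in.
by case: (x \in V) => //; apply: big1.
Qed.

Lemma sum_pred1 (x : T) (g : T -> nat) : \sum_y (y == x) * g y = g x.
Proof.
by rewrite (bigD1 x) //= eqxx mul1n big1 ?addn0 // => y /negbTE ->.
Qed.

Lemma vol_rem h V x : symmetric h -> vol h V <= vol h (V :\ x) + 2 * deg_in h V x.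
Proof.
move=> sh.
have E1 : \sum_a \sum_b (a == x) * ((b \in V) && h x b) = deg_in h V x.
  rewrite -sum_deg_in -(sum_pred1 x (fun=> \sum_y ((y \in V) && h x y : nat))).
  by apply: eq_bigr => a _; rewrite big_distrr.
have E2 : \sum_a \sum_b (b == x) * ((a \in V) && h x a) = deg_in h V x.
  by rewrite exchange_big -E1.
have le_ab a b : [&& a \in V, b \in V & h a b] <=
    [&& a \in V :\ x, b \in V :\ x & h a b] +
    ((a == x) * ((b \in V) && h x b) + (b == x) * ((a \in V) && h x a)).
  rewrite !inE; case: (eqVneq a x) => [->|ax]; case: (eqVneq b x) => [->|bx] /=;
    rewrite ?mul0n ?mul1n ?addn0 ?add0n ?andbF //.
  - by case: (x \in V); case: (h x x).
  - by case: (x \in V).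
  - by rewrite sh; case: (x \in V); rewrite ?andbF.
apply: (@leq_trans (\sum_a \sum_b ([&& a \in V :\ x, b \in V :\ x & h a b] +
    ((a == x) * ((b \in V) && h x b) + (b == x) * ((a \in V) && h x a))))).
  by apply: leq_sum => a _; apply: leq_sum => b _; exact: le_ab.
under eq_bigr => a _ do rewrite 2!big_split.
by rewrite 2!big_split /= E1 E2 mul2n addnn.
Qed.

(** Deleting a vertex of degree at most [q] costs at most [2 * q] ordered pairs, so the density
    hypothesis survives until no such vertex is left. *)
Lemma min_degree_subgraph h V q : symmetric h -> 2 * q * #|V| < vol h V ->
  exists V' : {set T}, [/\ V' \subset V, V' != set0 &
    forall x, x \in V' -> q < deg_in h V' x].
Proof.
move=> sh; move: {2}#|V|.+1 (ltnSn #|V|) => N.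
elim: N V => // N IH V; rewrite ltnS => VN volV.
have [/existsP[x /andP[xV dx]]|] := boolP [exists x, (x \in V) && (deg_in h V x <= q)].
  have cV := cardsD1 x V; rewrite xV add1n in cV.
  have [||V' [sV V0 dV]] := IH (V :\ x).
  - by rewrite -cV.
  - have := leq_trans volV (vol_rem V x sh).
    move: dx; rewrite cV mulnS; move: (deg_in _ _ _) (vol _ _) (2 * q * _) => a b c.
    by move=> aq; rewrite -ltnS => H; lia.
  by exists V'; split=> //; apply: subset_trans sV (subD1set _ _).
move=> /existsPn dV; exists V; split=> //; last first.
  by move=> x xV; have := dV x; rewrite xV /= -ltnNge.
apply/negP => /eqP V0; move: volV; rewrite V0 vol_deg big_set0 //.
Qed.

(** The density first gives minimum degree above [24 * k]. The Posa set [X] together with its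
    neighbours forms a set [D] on the cycle with [#|D| <= 3 * #|X|], containing all edges at [X], so
    [D] has more than [8 * k * #|D|] ordered pairs. A subgraph of [D] then has minimum degree above
    [4 * k], and the Moore bound applies to it. *)
Lemma theta_exists h V k r : symmetric h -> irreflexive h -> 0 < k ->
  (forall s, is_cycle h s -> r.*2 < size s) ->
  48 * k * #|V| < vol h V ->
  exists x0 c m, [/\ cycle (restr h V) c, uniq c & {subset c <= V}] /\
    [/\ (4 * k) ^ r <= size c, 1 < m, m + 1 < size c & h (nth x0 c 0) (nth x0 c m)].
Proof.
move=> sh ih k0 girth volV.
have [|V' [sV V'0 degV']] := @min_degree_subgraph h V (24 * k) sh; first by rewrite mulnA.
pose F := restr h V'.
have sF : symmetric F by move=> a b; apply/and3P/and3P => -[aV bV]; rewrite sh; split.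
have iF : irreflexive F by move=> a; apply/negP => /and3P[_ _]; rewrite ih.
have eF a b : F a b -> (a \in V') && (b \in V') by case/and3P=> -> ->.
have Fh a b : F a b -> h a b by case/and3P.
have degF x : x \in V' -> 24 * k < #|[set y | F x y]|.
  move=> xV; apply: leq_trans (degV' x xV) _; apply/subset_leq_card/subsetP => y.
  by rewrite !inE => /andP[yV hxy]; apply/and3P.
have [|X [x0 [c [m [[cc uc X0 XV' Dc] [Dle m1 m2 hm]]]]]] := long_chorded_cycle sF iF V'0 eF.
  by move=> x /degF; apply: leq_trans; lia.
have cV' : {subset c <= V'}.
  move=> z zc; have := next_cycle cc zc; by case/and3P.
exists x0, c, m; split; split=> //; last by exact: Fh.
- by apply: sub_cycle cc => a b /and3P[aV bV hab]; apply/and3P; rewrite hab !(subsetP sV).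
- by move=> z /cV'; apply: (subsetP sV).
pose D := X :|: nbrs F X; rewrite -/D in Dle Dc.
have volD : 2 * (4 * k) * #|D| < vol F D.
  have DX : X \subset D by rewrite subsetUl.
  apply: (@leq_trans (\sum_(x in X) (24 * k).+1)); last first.
    rewrite vol_deg [X in _ <= X](big_setID X) /= (setIidPr DX).
    apply: leq_trans (leq_addr _ _); apply: leq_sum => x xX.
    apply: leq_trans (degF x (subsetP XV' x xX)) _.
    apply/subset_leq_card/subsetP => y; rewrite !inE => Fxy; rewrite Fxy andbT.
    by apply/orP; right; apply/existsP; exists x; rewrite xX.
  have := X0; rewrite -card_gt0 sum_nat_const; move: Dle.
  by move: #|D| #|X| => a b; nia.
have [V3 [sV3 V30 degV3]] := min_degree_subgraph sF volD.
apply: (@leq_trans #|V3|).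
  apply: (moore_bound sF iF V30 degV3) => s /andP[ss /andP[cs us]].
  by apply: girth; rewrite /is_cycle ss /ucycleb us (sub_cycle Fh cs).
rewrite -(card_uniqP uc); apply/subset_leq_card/subsetP => z /(subsetP sV3).
exact: Dc.
Qed.

End Volume.

(** * Bipartite, 2-connected and layered subgraphs *)

Section Subgraphs.
Variable T : finType.
Implicit Types (h : rel T) (V W : {set T}).

Lemma vol_subU h V V1 V2 :
  (forall a b, a \in V -> b \in V -> h a b ->
     (a \in V1) && (b \in V1) || (a \in V2) && (b \in V2)) ->
  vol h V <= vol h V1 + vol h V2.
Proof.
move=> H; rewrite /vol -big_split /=; apply: leq_sum => a _.
rewrite -big_split /=; apply: leq_sum => b _.
case: (boolP (h a b)) => hab; rewrite ?andbF ?andbT //.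
case: (boolP (a \in V)) => aV //; case: (boolP (b \in V)) => bV //=.
by have := H a b aV bV hab; case: (_ && _) => //; case: (_ && _).
Qed.

(** A minimal dense [W] has no cut vertex: two sides [W1], [W2] sharing only [x] satisfy
    [#|W1|.-1 + #|W2|.-1 = #|W|.-1], so if neither side is dense then neither is [W]. *)
Lemma two_connected_subgraph h d : symmetric h ->
  2 * d * #|T|.-1 < vol h setT ->
  exists W, 2 * d * #|W|.-1 < vol h W /\
    forall x y z, x \in W -> y \in W -> z \in W -> y != x -> z != x ->
      exists D n, upath (restr h W) D y z n /\ x \notin D.
Proof.
move=> sh volT.
pose P (W : {set T}) := 2 * d * #|W|.-1 < vol h W.
have PT : P setT by rewrite /P cardsT.
have [W /minsetP[PW minW] _] := minset_exists PT.
exists W; split=> // x y z xW yW zW yx zx.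
pose R := [rel a b | [&& restr h W a b, a != x & b != x]].
have sR : symmetric R.
  by move=> a b; apply/and3P/and3P => -[/and3P[aV bV hab] ax bx]; split=> //;
     apply/and3P; rewrite sh; split.
have [cyz|nyz] := boolP (connect R y z); first by apply: connect_avoid yx cyz.
pose C := [set a in W | connect R y a].
have xC : x \notin C.
  rewrite inE xW /=; apply/negP => /connectP[p hp Ex].
  have : last y p != x.
    by elim: p y hp yx {Ex yW nyz C} => //= b p IH a /andP[/and3P[_ _ bx] hp] _; apply: IH.
  by rewrite -Ex eqxx.
have CW : C \subset W by apply/subsetP => a; rewrite inE => /andP[].
have CR a b : a \in C -> b \in W -> h a b -> b != x -> b \in C.
  rewrite !inE => /andP[aW ya] bW hab bx; rewrite bW /=.
  apply: (connect_trans ya); apply: connect1; apply/and3P; split=> //.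
    by apply/and3P.
  by apply: contraNneq xC => Ea; rewrite inE xW -Ea.
pose W1 := x |: C; pose W2 := W :\: C.
have W1W : W1 \subset W by rewrite subUset sub1set xW.
have W2W : W2 \subset W by rewrite subsetDl.
have c1 : #|W1| = #|C|.+1 by rewrite cardsU1 xC.
have c2 : #|C| + #|W2| = #|W| by rewrite -(cardsID C W) (setIidPr CW).
have xW2 : x \in W2 by rewrite inE xC.
have P1 : vol h W1 <= 2 * d * #|W1|.-1.
  rewrite leqNgt; apply/negP => /minW /(_ W1W) E.
  by have := zW; rewrite -E !inE (negbTE zx) zW (negbTE nyz).
have P2 : vol h W2 <= 2 * d * #|W2|.-1.
  rewrite leqNgt; apply/negP => /minW /(_ W2W) E.
  by have := yW; rewrite -E !inE yW connect0.
have volW : vol h W <= vol h W1 + vol h W2.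
  apply: vol_subU => a b aW bW hab; rewrite !in_setU1 !in_setD aW bW !andbT.
  have [aC|aC] := boolP (a \in C); have [bC|bC] := boolP (b \in C);
    rewrite ?orbT ?orbF //=.
    by apply: contraNT bC; apply: CR aC bW hab.
  by rewrite andbT; apply: contraNT aC; apply: (CR b) => //; rewrite sh.
move: PW; rewrite /P ltnNge => /negP; case.
apply: leq_trans volW _; apply: leq_trans (leq_add P1 P2) _.
rewrite -mulnDr leq_mul2l; apply/orP; right; rewrite c1 -c2 /=.
have : 0 < #|W2| by apply/card_gt0P; exists x.
by case: #|W2| => // n _; rewrite addnS.
Qed.

(** Averaging over all 2-colourings: flipping the colour of one end shows that each edge is
    bichromatic in exactly half of them. *)
Lemma half_bipartite h : irreflexive h ->
  exists f : T -> bool, vol h setT <= 2 * vol [rel a b | h a b && (f a != f b)] setT.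
Proof.
move=> ih.
pose vf (f : {ffun T -> bool}) := vol [rel a b | h a b && (f a != f b)] setT.
apply: contrapT => nof.
have ltf f : 2 * vf f < vol h setT.
  by rewrite ltnNge; apply/negP => H; apply: nof; exists f.
pose F := #|{ffun T -> bool}|.
have F0 : 0 < F by apply/card_gt0P; exists [ffun=> true].
have : \sum_(f : {ffun T -> bool}) 2 * vf f < F * vol h setT.
  rewrite -sum_nat_const -[X in X < _]addn0 -ltn_subRL -sumnB; last first.
    by move=> f _; apply: ltnW.
  rewrite lt0n sum_nat_eq0; apply/negP => /forallP /(_ [ffun=> true]).
  by rewrite /= subn_eq0 leqNgt ltf.
rewrite ltnNge => /negP; apply.
have half a b : h a b -> 2 * \sum_(f : {ffun T -> bool}) (f a != f b) = F.
  move=> hab; have ab : b != a by apply: contraTneq hab => ->; rewrite ih.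
  pose flip (f : {ffun T -> bool}) := [ffun t => if t == a then ~~ f t else f t].
  have flipK : involutive flip.
    by move=> f; apply/ffunP => t; rewrite !ffunE; case: eqP => // _; rewrite negbK.
  rewrite mul2n -addnn {1}(reindex_inj (inv_inj flipK)) -big_split /=.
  rewrite /F -sum1_card; apply: eq_bigr => f _.
  by rewrite !ffunE eqxx (negbTE ab); case: (f a); case: (f b).
rewrite -big_distrr /= /vf /vol.
rewrite [X in _ <= 2 * X]exchange_big /= !big_distrr /=; apply: leq_sum => a _.
rewrite [X in _ <= 2 * X]exchange_big /= !big_distrr /=; apply: leq_sum => b _.
rewrite !inE /=; case: (boolP (h a b)) => [hab|]; last by rewrite muln0.
by rewrite muln1 -(half a b hab).
Qed.

(** On [W], [lev] is the distance from [u] and [par] is the last but one vertex of a shortest walk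
    from [u]; outside [W] the values are arbitrary. *)
Lemma bfs_tree h W u : (forall a b, h a b -> (a \in W) && (b \in W)) -> u \in W ->
  (forall x, x \in W -> connect h u x) ->
  exists (lev : T -> nat) (par : T -> T),
    [/\ lev u = 0, forall x y, h x y -> lev y <= (lev x).+1 &
        forall x, x \in W -> x != u -> h (par x) x /\ lev x = (lev (par x)).+1].
Proof.
move=> hW uW conn.
pose walk x n := exists p, [/\ path h u p, last u p = x & size p = n].
have /choice[lev levP] : forall x, exists n, x \in W ->
    walk x n /\ forall n', walk x n' -> n <= n'.
  move=> x; case: (boolP (x \in W)) => xW; last by exists 0.
  have ex : exists n, `[< walk x n >].
    have /connectP[p hp ->] := conn x xW.
    by exists (size p); apply/asboolP; exists p.
  case: (ex_minnP ex) => n /asboolP wn nmin.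
  by exists n => _; split=> // n' wn'; apply: nmin; apply/asboolP.
have lev_edge x y : h x y -> lev y <= (lev x).+1.
  move=> hxy; have /andP[xW yW] := hW _ _ hxy.
  have [[p [hp lp <-]] _] := levP x xW; apply: (levP y yW).2.
  by exists (rcons p y); rewrite rcons_path last_rcons size_rcons hp lp.
have /choice[par parP] : forall x, exists y, x \in W -> x != u ->
    h y x /\ lev x = (lev y).+1.
  move=> x; case: (boolP (x \in W)) => xW; last by exists x.
  have [[p [hp lp sp]] _] := levP x xW.
  case: (lastP p) hp lp sp => [|q z]; first by move=> _ <- _; exists u; rewrite eqxx.
  rewrite rcons_path last_rcons size_rcons => /andP[hq hz] Ez sq; subst z.
  exists (last u q) => _ _; split=> //; apply/eqP; rewrite eqn_leq lev_edge //=.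
  rewrite -sq ltnS; have /andP[yW _] := hW _ _ hz.
  by apply: (levP _ yW).2; exists q.
exists lev, par; split=> //.
by apply/eqP; rewrite -leqn0; apply: (levP u uW).2; exists [::].
Qed.

Lemma sum_ord_le1 N (g : nat -> nat) a : injective g -> \sum_(i < N) (g i == a) <= 1.
Proof.
move=> gi; have [/existsP[i0 /eqP Ei]|] := boolP [exists i : 'I_N, g i == a].
  rewrite (bigD1 i0) //= Ei eqxx big1 // => i; apply: contraNeq.
  by rewrite eqb0 negbK -Ei => /eqP/gi/val_inj ->.
by move=> /existsPn H; rewrite big1 // => i _; rewrite (negbTE (H i)).
Qed.

(** Each edge lies in the pair of levels starting at its smaller level, and each vertex in at most
    two such pairs; hence some pair is at least half as dense as [W]. *)
Lemma dense_level h W q (lev : T -> nat) :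
  (forall a b, h a b -> lev b = (lev a).+1 \/ lev a = (lev b).+1) ->
  q * (2 * #|W|) < vol h W ->
  exists i, q * #|[set x in W | (i == lev x) || (i.+1 == lev x)]| <
    vol h [set x in W | (i == lev x) || (i.+1 == lev x)].
Proof.
move=> hlev volW; apply: contrapT => noi.
pose V i := [set x in W | (i == lev x) || (i.+1 == lev x)].
have le i : vol h (V i) <= q * #|V i|.
  by rewrite leqNgt; apply/negP => H; apply: noi; exists i.
pose N := (\max_x lev x).+1.
have levN x : lev x < N by rewrite ltnS; apply: leq_bigmax.
have h1 : vol h W <= \sum_(i < N) vol h (V i).
  rewrite /vol [X in _ <= X]exchange_big /=; apply: leq_sum => a _.
  rewrite [X in _ <= X]exchange_big /=; apply: leq_sum => b _.
  case: (boolP [&& a \in W, b \in W & h a b]) => // /and3P[aW bW hab].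
  have mN : minn (lev a) (lev b) < N by rewrite (leq_ltn_trans (geq_minl _ _)).
  rewrite (bigD1 (Ordinal mN)) //= !inE aW bW hab /=.
  suff -> : [&& (minn (lev a) (lev b) == lev a) || ((minn (lev a) (lev b)).+1 == lev a),
      (minn (lev a) (lev b) == lev b) || ((minn (lev a) (lev b)).+1 == lev b) & true].
    by rewrite leq_addr.
  rewrite andbT; case: (hlev _ _ hab) => ->.
    by rewrite (minn_idPl (leqnSn _)) !eqxx orbT.
  by rewrite (minn_idPr (leqnSn _)) !eqxx orbT.
have h2 : \sum_(i < N) #|V i| <= 2 * #|W|.
  rewrite mulnC -sum_nat_const.
  have -> : \sum_(i < N) #|V i| =
      \sum_(x in W) \sum_(i < N) ((val i == lev x) || ((val i).+1 == lev x)).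
    rewrite exchange_big /=; apply: eq_bigr => i _.
    rewrite -sum1_card big_mkcond [RHS]big_mkcond /=; apply: eq_bigr => x _.
    by rewrite inE; case: (x \in W) => //=; case: (_ || _).
  apply: leq_sum => x _.
  apply: (@leq_trans (\sum_(i < N) ((val i == lev x) + ((val i).+1 == lev x)))).
    by apply: leq_sum => i _; case: (_ == _) => //=; rewrite leq_addr.
  rewrite big_split /= -[2]/(1 + 1); apply: leq_add.
    exact: (@sum_ord_le1 N id).
  by apply: (@sum_ord_le1 N succn) => ? ? [].
move: volW; rewrite ltnNge => /negP; apply; apply: leq_trans h1 _.
apply: (@leq_trans (\sum_(i < N) q * #|V i|)); first by apply: leq_sum.
by rewrite -big_distrr leq_mul2l h2 orbT.
Qed.

End Subgraphs.

(** * Odd cycles and odd ears *)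

Section Linking.
Variables (T : finType).
Implicit Types (h e : rel T) (W B D : {set T}).

(** The linking paths contribute a fixed length [n0], so varying the path inside [B] varies only
    [n]. If [w] is linked to [v], the whole path is reversed. *)
Lemma two_linked_upath h u v B w : symmetric h -> u != v ->
  two_linked h [set u; v] B w ->
  exists y n0, [/\ y \in B, y != w & forall D n, upath h D w y n -> D \subset B ->
    exists D', upath h D' u v (n0 + n)].
Proof.
move=> sh uv [a [b [y [D1 [D2 [n1 [n2 [[P1 P2 dis yB Eab] [yw I1 I2]]]]]]]]].
exists y, (n1 + n2); split=> // D n P sD.
have Pab : upath h (D1 :|: D :|: D2) a b (n1 + n + n2).
  apply: upath_cat (upath_cat P1 P _) (upath_rev sh P2) _.
    by move=> c d c1 dD E; apply: I1; rewrite // E (subsetP sD).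
  move=> c d; rewrite inE => /orP[c1|cD] d2 E.
    by move: d2; rewrite -E (disjointFr dis).
  by rewrite E; apply: I2 => //; rewrite -E (subsetP sD).
have En : n1 + n2 + n = n1 + n + n2 by rewrite addnAC.
have : (a == u) || (a == v) by have := set21 a b; rewrite Eab !inE.
have : (b == u) || (b == v) by have := set22 a b; rewrite Eab !inE.
have ab : a != b.
  apply: contraNneq uv => ab; move: Eab; rewrite ab setUid => /setP Eab.
  have := Eab u; have := Eab v; rewrite !inE !eqxx ?orbT /=.
  by move=> /eqP -> /eqP ->.
rewrite En; case/orP=> /eqP Eb; case/orP=> /eqP Ea; subst a b.
- by rewrite eqxx in ab.
- by exists (D1 :|: D :|: D2); apply: upath_rev.
- by exists (D1 :|: D :|: D2).
- by rewrite eqxx in ab.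
Qed.

Lemma upath_connect h D x y n : upath h D x y n -> connect h x y.
Proof. by case/upath_path => p [hp <- _ _ _]; apply/connectP; exists p. Qed.

Lemma connected_of_avoid h W : 2 < #|W| ->
  (forall x y z, x \in W -> y \in W -> z \in W -> y != x -> z != x ->
      exists D n, upath h D y z n /\ x \notin D) ->
  forall y z, y \in W -> z \in W -> connect h y z.
Proof.
move=> W3 conn y z yW zW.
have : 0 < #|W :\: [set y; z]|.
  rewrite cardsD subn_gt0; apply: leq_ltn_trans W3.
  apply: leq_trans (subset_leq_card (subsetIr _ _)) _.
  by rewrite cards2; case: (y == z).
case/card_gt0P => x; rewrite !inE negb_or => /andP[/andP[xy xz] xW].
rewrite eq_sym in xy; rewrite eq_sym in xz.
by have [D [n [/upath_connect]]] := conn x y z xW yW zW xy xz.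
Qed.

Lemma upath_loop h D x n : upath h D x x n -> n = 0.
Proof.
move=> P; inversion P as [|a b c E m hab xE P' EE Ea Ec Em]; subst=> //.
by case/negP: xE; exact: upath_end P'.
Qed.

(** An inner vertex in [W] cuts the path into two shorter ones, of which at least one again has the
    wrong parity. *)
Lemma odd_ear e W (f : T -> bool) D u v n : upath e D u v n -> u \in W -> v \in W ->
  odd n != (f u != f v) ->
  exists D' u' v' n', [/\ upath e D' u' v' n', u' != v', u' \in W, v' \in W &
    odd n' != (f u' != f v')] /\
    forall a, a \in D' -> a \in W -> (a == u') || (a == v').
Proof.
move: {2}n.+1 (ltnSn n) => N; elim: N => // N IH in D u v n *.
rewrite ltnS => nN P uW vW par.
have uv : u != v.
  by apply: contraNneq par => E; subst v; rewrite eqxx (upath_loop P).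
have [/existsP[t /and3P[/andP[tD tW] tu tv]]|] :=
    boolP [exists t, [&& (t \in D) && (t \in W), t != u & t != v]].
  have [D1 [D2 [n1 [n2 [P1 P2 _ _ En]]]]] := upath_split P tD.
  have n10 : 0 < n1.
    by rewrite lt0n; apply: contra tu => /eqP E; move: P1; rewrite E => P1; inversion P1.
  have n20 : 0 < n2.
    by rewrite lt0n; apply: contra tv => /eqP E; move: P2; rewrite E => P2; inversion P2.
  have : (odd n1 != (f u != f t)) || (odd n2 != (f t != f v)).
    move: par; rewrite En oddD.
    by case: (odd n1) (odd n2) (f u) (f t) (f v) => [] [] [] [] [].
  case/orP; [apply: IH P1 _ _ | apply: IH P2 _ _] => //; apply: leq_trans nN; rewrite En.
    by rewrite -addn1 leq_add2l.
  by rewrite -add1n leq_add2r.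
move=> /existsPn nt; exists D, u, v, n; split=> [|a aD aW]; first by split.
by have := nt a; rewrite aD aW /= negb_and !negbK.
Qed.

Lemma cycle_two_arcs h c x y : symmetric h -> cycle h c -> uniq c ->
  x \in c -> y \in c -> x != y ->
  exists E1 E2 l1 l2, [/\ upath h E1 x y l1, upath h E2 x y l2,
    {subset E1 <= c}, {subset E2 <= c} & l1 + l2 = size c].
Proof.
move=> sh + + xc; have [i c' Ec] := rot_to xc.
rewrite -(rot_cycle i) -(rot_uniq i) -(size_rot i) -(mem_rot i c y) => cc uc yc xy.
have memc : c =i rot i c by move=> z; rewrite mem_rot.
suff [E1 [E2 [l1 [l2 [P1 P2 s1 s2 El]]]]] : exists E1 E2 l1 l2,
    [/\ upath h E1 x y l1, upath h E2 x y l2,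
    {subset E1 <= rot i c}, {subset E2 <= rot i c} & l1 + l2 = size (rot i c)].
  by exists E1, E2, l1, l2; split=> // z; rewrite memc; auto.
move: (rot i c) Ec cc uc yc => {memc i xc} {}c Ec cc uc yc.
have c0 : 0 < size c by rewrite Ec.
have Ex : cnth x c 0 = x by rewrite /cnth mod0n Ec.
have lty : index y c < size c by rewrite index_mem.
have Ey : cnth x c (index y c) = y by rewrite /cnth modn_small // nth_index.
have y0 : 0 < index y c.
  rewrite lt0n; apply: contra xy => /eqP E; by rewrite -Ey E Ex.
have P1 := arc_upath x cc uc c0 0 lty.
have ltn' : size c - index y c < size c by lia.
have P2 := arc_upath x cc uc c0 (index y c) ltn'.
exists (cycle_arc x c 0 (index y c)), (cycle_arc x c (index y c) (size c - index y c)),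
  (index y c), (size c - index y c); split.
- by move: P1; rewrite add0n Ex Ey.
- apply: upath_rev => //; move: P2; rewrite Ey subnKC ?(ltnW lty) //.
  by rewrite -[in cnth _ _ (size c)](add0n (size c)) cnthD Ex.
- exact: arc_sub.
- exact: arc_sub.
by rewrite subnKC // ltnW.
Qed.

Lemma dup_split (A : eqType) (s : seq A) : ~~ uniq s ->
  exists s1 y s2, s = s1 ++ y :: s2 /\ y \in s2.
Proof.
elim: s => // a s IH; rewrite cons_uniq negb_and negbK => /orP[as1|/IH].
  by exists [::], a, s.
by case=> s1 [y [s2 [-> ys2]]]; exists (a :: s1), y, s2.
Qed.

(** At a repeated vertex a closed walk of odd length splits into two shorter closed walks, one of
    them odd. *)
Lemma shortest_odd_cycle e c : cycle e c -> odd (size c) ->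
  exists c', [/\ cycle e c', odd (size c') & uniq c'].
Proof.
move=> cc oc.
pose P n := `[< exists c, [/\ cycle e c, odd (size c) & size c = n] >].
have exP : exists n, P n by exists (size c); apply/asboolP; exists c.
case: (ex_minnP exP) => n /asboolP[c' [cc' oc' <-]] nmin.
exists c'; split=> //; apply/negPn/negP => /dup_split[s1 [y [s2 [Ec ys2]]]].
have lt_absurd d : cycle e d -> odd (size d) -> size d < size c' -> False.
  move=> cd od; rewrite ltnNge => /negP; apply; apply: nmin.
  by apply/asboolP; exists d.
have sz : size ((y :: s2) ++ s1) = size c' by rewrite Ec !size_cat addnC.
move: cc'; rewrite Ec cycle_catC cat_cons.
case/splitPr: ys2 sz {Ec} => d1 d2 sz.
rewrite -catA cat_cons /= rcons_cat cat_path rcons_cons /= => /and3P[p1 p2 p3].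
have cd1 : cycle e (y :: d1) by rewrite /= rcons_path p1.
have cd2 : cycle e (y :: (d2 ++ s1)) by [].
have {}sz : size (y :: d1) + size (y :: (d2 ++ s1)) = size c'.
  by rewrite -sz /= !size_cat /= !(addnS, addSn) addnA.
have [o1|o1] := boolP (odd (size (y :: d1))).
  by apply: lt_absurd cd1 o1 _; rewrite -sz -[X in X < _]addn0 ltn_add2l.
apply: lt_absurd cd2 _ _; last by rewrite -sz -[X in X < _]add0n ltn_add2r.
by move: oc'; rewrite -sz oddD (negbTE o1).
Qed.

End Linking.

(** * Breadth-first trees *)

Section Tree.
Variables (T : finType) (h : rel T) (W : {set T}) (u : T) (lev : T -> nat) (par : T -> T).
Hypotheses (sym_h : symmetric h)
  (edge_W : forall a b, h a b -> (a \in W) && (b \in W)) (lev_u : lev u = 0)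
  (par_edge : forall x, x \in W -> x != u -> h (par x) x /\ lev x = (lev (par x)).+1).

(** The vertex [x] itself is included, so this is the vertex set of a tree path with [j] edges. *)
Definition ancestors x j : {set T} := [set z in traject par x j.+1].

Lemma ancestorsP x j z : z \in ancestors x j -> exists2 i, i <= j & z = iter i par x.
Proof. by rewrite inE => /trajectP[i ij ->]; exists i. Qed.

Lemma mem_ancestors x i j : i <= j -> iter i par x \in ancestors x j.
Proof. by move=> ij; rewrite inE; apply/trajectP; exists i. Qed.

Lemma lev_iter x i : x \in W -> i <= lev x ->
  iter i par x \in W /\ lev (iter i par x) = lev x - i.
Proof.
move=> xW; elim: i => [|i IH] ix; first by rewrite subn0.
have [yW ly] := IH (ltnW ix).
have yu : iter i par x != u.
  apply: contraTneq ix => E; move: ly.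
  by rewrite E lev_u => /esym/eqP; rewrite subn_eq0 -ltnNge ltnS.
have [/edge_W/andP[pW _] ll] := par_edge yW yu.
by split=> //; rewrite /= subnS -ly ll.
Qed.

Lemma iter_eq x y i j : x \in W -> y \in W -> i <= lev x -> j <= lev y -> lev x = lev y ->
  iter i par x = iter j par y -> i = j.
Proof.
move=> xW yW ix jy lxy E.
have [_ l1] := lev_iter xW ix; have [_ l2] := lev_iter yW jy.
move: l1; rewrite E l2 lxy => /eqP; rewrite eqn_sub2lE //; last by rewrite -lxy.
by move=> /eqP.
Qed.

Lemma ancestors_upath x j : x \in W -> j <= lev x ->
  upath h (ancestors x j) x (iter j par x) j.
Proof.
elim: j x => [|j IH] x xW jx.
  by apply: upath_eq (upath0 h x) _ => z; rewrite !inE.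
have xu : x != u by apply: contraTneq jx => ->; rewrite lev_u.
have [hx lx] := par_edge xW xu.
have /andP[pW _] := edge_W hx.
have jp : j <= lev (par x) by rewrite -ltnS -lx.
rewrite iterSr; apply: upath_eq (upathS _ _ (IH _ pW jp)) _.
- by rewrite sym_h.
- apply/negP => /ancestorsP[i ij E].
  have [_ /eqP] := lev_iter pW (leq_trans ij jp).
  by rewrite -E lx; apply/negP; rewrite neq_ltn ltnS leq_subr orbT.
- by move=> z; rewrite !inE.
Qed.

Lemma ancestors_root x : x \in W -> iter (lev x) par x = u.
Proof.
move=> xW; have [yW ly] := lev_iter xW (leqnn _).
by apply/eqP/negPn/negP => /(par_edge yW)[_]; rewrite ly subnn.
Qed.

Lemma lev_parity (f : T -> bool) x : (forall a b, h a b -> f a != f b) ->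
  x \in W -> odd (lev x) = (f x != f u).
Proof.
by move=> fP xW; rewrite (upath_parity fP (ancestors_upath xW (leqnn _))) ancestors_root.
Qed.

End Tree.

(** * Paths of both parities in a 2-connected non-bipartite graph *)

Section BothParities.
Variables (T : finType) (e : rel T).
Hypotheses (sym_e : symmetric e) (irr_e : irreflexive e) (T3 : 2 < #|T|)
  (nonbip : ~ bipartite e)
  (conn_e : forall x y z, y != x -> z != x -> exists D n, upath e D y z n /\ x \notin D).

Let edge_T a b : e a b -> (a \in [set: T]) && (b \in [set: T]).
Proof. by rewrite !inE. Qed.

Lemma connectT y z : connect e y z.
Proof.
by apply: (@connected_of_avoid _ e setT); rewrite ?cardsT ?inE // => *; apply: conn_e.
Qed.

(** Some edge joins two levels of equal parity, since otherwise the parity of the level is a proper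
    2-colouring. With the tree paths to the root it forms an odd closed walk. *)
Lemma odd_cycle : exists c, [/\ cycle e c, odd (size c) & uniq c].
Proof.
have /card_gt0P[u _] : 0 < #|T| by apply: leq_ltn_trans T3.
have [lev [par [l0 _ lp]]] := bfs_tree edge_T (in_setT u) (fun x _ => connectT u x).
have [x [y [exy oxy]]] : exists x y, e x y /\ odd (lev x) = odd (lev y).
  apply: contrapT => nxy; apply: nonbip; exists (fun x => odd (lev x)) => x y exy.
  by apply/negP => /eqP oxy; apply: nxy; exists x, y.
have [p [hp lastp _ sp _]] := upath_path (upath_rev sym_e
  (ancestors_upath sym_e edge_T l0 lp (in_setT x) (leqnn _))).
have [q [hq lastq _ sq _]] := upath_path
  (ancestors_upath sym_e edge_T l0 lp (in_setT y) (leqnn _)).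
rewrite !(ancestors_root edge_T l0 lp) ?inE // in hp lastp lastq.
apply: (@shortest_odd_cycle _ e (y :: q ++ p)).
  by rewrite /= rcons_cat cat_path hq lastq rcons_path hp lastp.
by rewrite /= size_cat sp sq oddD oxy addbb.
Qed.

(** Disjoint paths link [u] and [v] to an odd cycle, whose two arcs between the points of contact
    have different parity. *)
Lemma both_parities u v b : u != v -> exists D n, upath e D u v n /\ odd n = b.
Proof.
move=> uv; have [c [cc oc uc]] := odd_cycle.
pose B := [set z in c].
have c1 : 1 < size c.
  case: c cc oc {uc B} => [|x [|]] //=; by rewrite irr_e.
have [x xc] : exists x, x \in c by case: c c1 {cc oc uc B} => // x *; exists x; rewrite mem_head.
have [D0 [n0 P0]] := connect_upath (connectT u x).
have [|w [Q [n1 [PQ _ wB QB]]]] := upath_hit (B := B) P0; first by rewrite inE.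
have [b0 b0B b0w] : exists2 b0, b0 \in B & b0 != w.
  have : 0 < #|B :\ w|.
    by have := cardsD1 w B; rewrite wB cardsE (card_uniqP uc); move: c1; lia.
  by case/card_gt0P => b0; rewrite in_setD1 => /andP[]; exists b0.
have conn' x0 y z : x0 \in [set: T] -> y \in [set: T] -> z \in [set: T] ->
  y != x0 -> z != x0 -> exists D n, upath e D y z n /\ x0 \notin D.
  by move=> _ _ _; apply: conn_e.
have L := two_linkedP sym_e edge_T conn' (in_setT u) (in_setT v) uv (subsetT B)
  wB b0B b0w PQ QB.
have [y [n2 [yB yw LP]]] := two_linked_upath sym_e uv L.
rewrite inE in wB; rewrite inE in yB; rewrite eq_sym in yw.
have [E1 [E2 [l1 [l2 [P1 P2 s1 s2 El]]]]] := cycle_two_arcs sym_e cc uc wB yB yw.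
have [|D1 PD1] := LP _ _ P1; first by apply/subsetP => z /s1; rewrite inE.
have [|D2 PD2] := LP _ _ P2; first by apply/subsetP => z /s2; rewrite inE.
move: oc; rewrite -El oddD => ol.
have [E|E] := eqVneq (odd (n2 + l1)) b; first by exists D1, (n2 + l1).
exists D2, (n2 + l2); split=> //; move: E ol; rewrite !oddD.
by case: (odd n2) (odd l1) (odd l2) b {LP} => [] [] [] [].
Qed.

End BothParities.

(** * Paths through a chorded cycle lying on two levels *)

Section Fan.
Variables (T : finType) (h : rel T) (W : {set T}) (u : T) (lev : T -> nat) (par : T -> T).
Hypotheses (sym_h : symmetric h)
  (edge_W : forall a b, h a b -> (a \in W) && (b \in W)) (lev_u : lev u = 0)
  (par_edge : forall x, x \in W -> x != u -> h (par x) x /\ lev x = (lev (par x)).+1)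
  (lev_edge : forall a b, h a b -> lev b = (lev a).+1 \/ lev a = (lev b).+1).
Variables (i m t : nat) (x0 : T) (c : seq T).
Hypotheses (cyc_c : cycle h c) (uniq_c : uniq c) (cW : {subset c <= W})
  (lev_c : forall z, z \in c -> lev z = i \/ lev z = i.+1)
  (m_gt1 : 1 < m) (m_ltn : m + 1 < size c) (chord : h (nth x0 c 0) (nth x0 c m))
  (t_le : 2 * t + 2 <= size c).

Let c_gt0 : 0 < size c. Proof. by apply: leq_ltn_trans m_ltn. Qed.
Let cc := cnth x0 c.
Let base : {set T} := [set z | (z \in c) && (lev z == i)].

Let baseW x : x \in base -> x \in W.
Proof. by rewrite inE => /andP[/cW]. Qed.

Let lev_base x : x \in base -> lev x = i.
Proof. by rewrite inE => /andP[_ /eqP]. Qed.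

Let cc_mem k : cc k \in c. Proof. exact: cnth_mem. Qed.

Let in_base k : (cc k \in base) = (lev (cc k) == i).
Proof. by rewrite inE cc_mem. Qed.

Let base_step k : (cc k.+1 \in base) = (cc k \notin base).
Proof.
rewrite !in_base; have := lev_edge (cnth_edge x0 cyc_c c_gt0 k).
move: (lev_c (cc_mem k)) (lev_c (cc_mem k.+1)); rewrite /cc.
by move: (lev _) (lev _) => a b; clear; lia.
Qed.

Let base_odd k : (cc k \in base) = (cc 0 \in base) (+) odd k.
Proof. by elim: k => [|k IH]; rewrite ?addbF // base_step IH /= addbN. Qed.

Let cc_index z : z \in c -> exists k, z = cc k.
Proof. by move=> zc; exists (index z c); rewrite /cc /cnth modn_small ?index_mem // nth_index. Qed.

(** Indices [k] and [k + 2] lie on the same level, and the chord forces at least four vertices. *)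
Let base_two : exists a b, [/\ a \in base, b \in base & a != b].
Proof.
have inj2 k : cc k != cc (k + 2).
  apply/eqP => /(cnth_inj (k := k) cyc_c uniq_c c_gt0) E.
  have {}E : k = k + 2 by apply: E; move: m_gt1 m_ltn; clear; lia.
  by move: E; clear; lia.
case: (boolP (cc 0 \in base)) => b0.
  by exists (cc 0), (cc 2); split; rewrite ?(inj2 0) // base_odd b0.
by exists (cc 1), (cc 3); split; rewrite ?(inj2 1) // base_odd (negbTE b0).
Qed.

Let anc_level x j z : x \in base -> j <= i -> z \in ancestors par x j ->
  z \in W /\ i - j <= lev z <= i.
Proof.
move=> xb ji /ancestorsP[l lj ->].
have [|zW ->] := lev_iter edge_W lev_u par_edge (baseW xb) (i := l).
  by rewrite (lev_base xb) (leq_trans lj).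
by rewrite (lev_base xb) leq_sub2l ?leq_subr.
Qed.

Let anc_cycle x j z : x \in base -> j <= i -> z \in ancestors par x j -> z \in c -> z = x.
Proof.
move=> xb ji /ancestorsP[l lj ->] zc.
have [|_] := lev_iter edge_W lev_u par_edge (baseW xb) (i := l).
  by rewrite (lev_base xb) (leq_trans lj).
rewrite (lev_base xb) => E; have li := leq_trans lj ji.
have l0 : l = 0 by case: (lev_c zc); rewrite E; move: li; clear; lia.
by rewrite l0.
Qed.

Let anc_eq x y l l' : x \in base -> y \in base -> l <= i -> l' <= i ->
  iter l par x = iter l' par y -> l = l'.
Proof.
move=> xb yb li l'i E.
by apply: (iter_eq edge_W lev_u par_edge (baseW xb) (baseW yb) _ _ _ E);
  rewrite ?(lev_base xb) ?(lev_base yb).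
Qed.

Lemma theta_fan : exists (S : {set T}) w b0 Q n,
  [/\ S \subset W, w \in S, b0 \in S, b0 != w & upath h Q u w n] /\
  (forall z, z \in Q -> z \in S -> z = w) /\
  forall s, s \in S -> s != w -> exists l0, forall k, k < t ->
    exists D, upath h D w s (l0 + 2 * k) /\ D \subset S.
Proof.
have [a0 [b0 [a0b b0b ab0]]] := base_two.
(* The least [j] for which all vertices of [base] have the same [j]-th ancestor yields their lowest
   common ancestor [w]; [j = i] works, with ancestor [u]. *)
pose P j := [forall x in base, forall y in base, iter j par x == iter j par y].
have PP j : reflect {in base &, forall x y, iter j par x = iter j par y} (P j).
  apply: (iffP forall_inP) => [H x y xb yb|H x xb].
    by have /forall_inP/(_ y yb)/eqP := H x xb.
  by apply/forall_inP => y yb; apply/eqP/H.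
have Pi : P i.
  apply/PP => x y xb yb; rewrite -{1}(lev_base xb) -(lev_base yb).
  by rewrite !(ancestors_root edge_W lev_u par_edge) ?baseW.
have [j /PP Pj jmin] := ex_minnP (ex_intro P i Pi).
have ji : j <= i by apply: jmin.
have j0 : 0 < j.
  rewrite lt0n; apply: contra ab0 => /eqP E; apply/eqP.
  by have := Pj a0 b0 a0b b0b; rewrite E.
pose w := iter j par a0.
have Ew x : x \in base -> iter j par x = w by move=> xb; apply: Pj.
pose S := [set z in c] :|: \bigcup_(x in base) ancestors par x j.
have cS z : z \in c -> z \in S by rewrite !inE => ->.
have aS x l z : x \in base -> l <= j -> z \in ancestors par x l -> z \in S.
  move=> xb lj /ancestorsP[l' l'l ->]; rewrite inE; apply/orP; right.
  by apply/bigcupP; exists x => //; apply: mem_ancestors (leq_trans l'l lj).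
have cb z : z \in base -> z \in c by rewrite inE => /andP[].
have [wW lw] : w \in W /\ lev w = i - j.
  have := lev_iter edge_W lev_u par_edge (baseW a0b) (i := j).
  by rewrite (lev_base a0b) => /(_ ji).
have up x l : x \in base -> l <= i -> upath h (ancestors par x l) x (iter l par x) l.
  move=> xb li; apply: (ancestors_upath sym_h edge_W lev_u par_edge (baseW xb)).
  by rewrite (lev_base xb).
exists S, w, a0, (ancestors par w (i - j)), (i - j); split; [split|split].
- apply/subsetP => z; rewrite inE => /orP[|/bigcupP[x xb zx]]; first by rewrite inE => /cW.
  by have [] := anc_level xb ji zx.
- by apply: aS (leqnn j) (mem_ancestors _ _ (leqnn j)).
- exact: cS (cb _ a0b).
- apply/eqP => E; move: lw; rewrite -E (lev_base a0b); move: j0 ji; clear; lia.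
- have := ancestors_upath sym_h edge_W lev_u par_edge wW (leqnn _).
  by rewrite (ancestors_root edge_W lev_u par_edge) // lw => /(upath_rev sym_h).
(* Levels are at most [i - j] on [Q] and at least [i - j] on [S], with equality on [Q] only at
   [w]. *)
- move=> z /ancestorsP[l lij Ez] zS.
  have [|_ lz] := lev_iter edge_W lev_u par_edge wW (i := l); first by rewrite lw.
  suff l0 : l = 0 by rewrite Ez l0.
  have : i - j <= lev z.
    move: zS; rewrite inE => /orP[|/bigcupP[x xb zx]].
      by rewrite inE => /lev_c[] ->; move: ji; clear; lia.
    by have [_ /andP[]] := anc_level xb ji zx.
  by rewrite Ez lz lw; move: lij; clear; lia.
move=> s sS sw; have [sc|sc] := boolP (s \in c).
  have [k0 Es] := cc_index sc.
  (* The walk along the cycle from [s] must end in [base], so its length is even if [s] is in [base]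
     and odd otherwise; the tree path to [w] adds [j]. *)
  exists (j + (2 - (s \notin base))) => k kt.
  pose l := 2 - (s \notin base) + 2 * k.
  have ln : l < size c.
    by rewrite /l; move: t_le kt; case: (s \notin base) => /=; clear; lia.
  have ab : cc (k0 + l) \in base.
    rewrite base_odd oddD addbA -base_odd -Es /l oddD oddM addbF.
    by case: (s \in base).
  exists (ancestors par (cc (k0 + l)) j :|: cycle_arc x0 c k0 l); split; last first.
    apply/subsetP => z; rewrite inE => /orP[|/(arc_sub c_gt0)]; last exact: cS.
    exact: aS.
  rewrite -addnA -/l.
  have P1 := upath_rev sym_h (up _ _ ab ji); rewrite Ew // in P1.
  have P2 := upath_rev sym_h (arc_upath x0 cyc_c uniq_c c_gt0 k0 ln).
  rewrite -/cc -Es in P2; apply: upath_cat P1 P2 _ => z z' z1 z2 E.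
  by apply: anc_cycle z1 _ => //; rewrite E; apply: arc_sub z2.
have [x xb [l lj El]] : exists2 x, x \in base & exists2 l, l <= j & s = iter l par x.
  move: sS; rewrite !inE (negbTE sc) => /bigcupP[x xb /ancestorsP[l lj El]].
  by exists x => //; exists l.
have {}lj : l < j.
  rewrite ltn_neqAle lj andbT; apply: contra sw => /eqP E.
  by rewrite El E Ew.
have li : l <= i by apply: leq_trans ji; apply: ltnW.
(* The vertices of [base] below [s]. They are not all of [base], because [l < j] and [j] is
   minimal. *)
pose A1 : pred T := fun z => (z \in base) && (iter l par z == s).
have [y yb yl] : exists2 y, y \in base & iter l par y != s.
  apply: contrapT => ny; move: lj; rewrite ltnNge => /negP; apply; apply: jmin.
  have Hs z : z \in base -> iter l par z = s.
    by move=> zb; apply/eqP/negPn/negP => zs; apply: ny; exists z.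
  by apply/PP => z z' zb z'b; rewrite !Hs.
have xA : A1 x by rewrite /A1 xb El eqxx.
(* The path descends [j] levels from [w] to a vertex of [base] not below [s], takes [2 * k.+1] steps
   to a vertex below [s], and climbs [l] levels to [s]. *)
exists (j + 2 + l) => k kt; pose n := 2 * k.+1.
have nc : 0 < n < size c by rewrite /n; move: t_le kt; clear; lia.
have chord' : h (cnth x0 c 0) (cnth x0 c m).
  by rewrite /cnth mod0n modn_small // -[m]addn0; apply: leq_trans m_ltn; rewrite addn0 addn1.
(* Invariance of [A1] under shifts by 2 is impossible: [x] is in [A1], [y] is not, and their indices
   have equal parity as both are in [base]. *)
case: (theta_upath cyc_c uniq_c c_gt0 sym_h m_gt1 m_ltn chord' A1 nc); last first.
  move=> per; case/idP: (negbF xA).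
  have perk q r : A1 (cc (q + 2 * r)) = A1 (cc q).
    by elim: r => [|r IH]; rewrite ?addn0 // mulnSr addnA [LHS]per.
  have [kx Ex] := cc_index (cb _ xb); have [ky Ey] := cc_index (cb _ yb).
  have odd_eq : odd kx = odd ky.
    move: xb yb; rewrite Ex Ey (base_odd kx) (base_odd ky).
    by case: (_ \in _) (odd kx) (odd ky) => [] [] [].
  have yA : ~~ A1 y by rewrite /A1 yb.
  have : A1 (cc kx) = A1 (cc ky).
    wlog le : kx ky {Ex Ey} odd_eq / kx <= ky.
      move=> H; case: (leqP kx ky) => [|/ltnW] le; first exact: H.
      by apply/esym/H.
    have -> : ky = kx + 2 * (ky - kx)./2.
      by rewrite mul2n halfK oddB // odd_eq addbb subn0 subnKC.
    by rewrite perk.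
  by rewrite -Ex -Ey (negbTE yA) => ->.
move=> [D [a [b [PD /andP[ab /eqP al] bA Dc]]]].
have bc : b \in c by apply: Dc; exact: upath_end PD.
have bb : b \in base.
  have [kb Eb] := cc_index bc; have [ka Ea] := cc_index (cb _ ab).
  have fP p q : h p q -> odd (lev p) != odd (lev q).
    by case/lev_edge => -> /=; case: (odd _).
  have := upath_parity fP PD; rewrite /n oddM /= => /esym/negbFE/eqP.
  rewrite (lev_base ab) inE bc /=.
  by case: (lev_c bc) => ->; rewrite ?eqxx //=; case: (odd i).
have bl : iter l par b != s by move: bA; rewrite /A1 bb.
have Pb := upath_rev sym_h (up _ _ bb ji); rewrite Ew // in Pb.
have Pa := up _ _ ab li; rewrite al in Pa.
exists (ancestors par b j :|: D :|: ancestors par a l); split; last first.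
  apply/subsetP => z /setUP[/setUP[|/Dc]|]; [exact: aS|exact: cS|].
  by apply: aS => //; apply: ltnW.
have -> : j + 2 + l + 2 * k = j + n + l by rewrite addnAC /n mulnS addnA.
have Pab : upath h (ancestors par b j :|: D) w a (j + n).
  apply: upath_cat Pb (upath_rev sym_h PD) _ => z z' z1 z2 E.
  by apply: anc_cycle z1 _ => //; rewrite E; apply: Dc.
apply: upath_cat Pab Pa _ => z z'; rewrite in_setU => z1 z2 E; subst z'.
case/orP: z1 => [z1|/Dc zc]; last by apply: anc_cycle z2 zc.
(* A vertex common to both tree paths is the [p]-th ancestor of [a] and of [b] with [p <= l], which
   would put [b] below [s] as well. *)
case/ancestorsP: z1 z2 => p pj Ez /ancestorsP[q ql].
rewrite Ez => Eq; have Epq : p = q.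
  apply: (anc_eq bb ab) Eq; [exact: leq_trans ji | exact: leq_trans li].
case/negP: bl; apply/eqP; rewrite -al -(subnK ql) !iterD.
by rewrite -Eq Epq.
Qed.

End Fan.

(** * Assembling the odd cycles *)

Lemma bipartite_upaths (T : finType) (h : rel T) (W : {set T}) (f : T -> bool) k r u v :
  symmetric h -> (forall a b, h a b -> (a \in W) && (b \in W)) ->
  (forall a b, h a b -> f a != f b) ->
  (forall x y z, x \in W -> y \in W -> z \in W -> y != x -> z != x ->
      exists D n, upath h D y z n /\ x \notin D) ->
  2 < #|W| -> 0 < k -> 0 < r ->
  (forall s, is_cycle h s -> r.*2 < size s) ->
  192 * k * #|W|.-1 < vol h W ->
  u \in W -> v \in W -> u != v ->
  exists l0, forall i, i < k ^ r -> exists D, upath h D u v (l0 + 2 * i).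
Proof.
move=> sh hW fP conn W3 k0 r0 girth volW uW vW uv.
have ih : irreflexive h.
  by move=> a; apply/negP => /fP; rewrite eqxx.
have [|lev [par [lu le lp]]] := bfs_tree hW uW.
  by move=> x xW; apply: connected_of_avoid W3 conn _ _ uW xW.
have lev_edge a b : h a b -> lev b = (lev a).+1 \/ lev a = (lev b).+1.
  move=> hab; have /andP[aW bW] := hW _ _ hab.
  have : odd (lev a) != odd (lev b).
    rewrite !(lev_parity sh hW lu lp fP) //.
    by move: (fP _ _ hab); case: (f a) (f b) (f u) => [] [] [].
  have hba : h b a by rewrite sh.
  move: (le _ _ hab) (le _ _ hba); move: (lev a) (lev b) => p q; clear.
  rewrite leq_eqVlt => /orP[/eqP ->|]; first by left.
  rewrite ltnS => qp; rewrite leq_eqVlt => /orP[/eqP ->|]; first by right.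
  rewrite ltnS => pq; have -> : p = q by apply/eqP; rewrite eqn_leq pq.
  by rewrite eqxx.
(* Here [192 * k * #|W|.-1] is at least [48 * k * (2 * #|W|)], because [#|W| >= 2]. *)
have [|i voli] := @dense_level _ h W (48 * k) lev lev_edge.
  apply: leq_ltn_trans volW; move: W3; case: #|W| => [|[|n]] // _.
  by move=> /=; clear; nia.
set V := [set x in W | _] in voli.
have [x0 [c [m [[cc uc cV] [sc m1 m2 hm]]]]] := theta_exists sh ih k0 girth voli.
have cW : {subset c <= W} by move=> z /cV; rewrite inE => /andP[].
have lc z : z \in c -> lev z = i \/ lev z = i.+1.
  by move=> /cV; rewrite inE => /andP[_ /orP[] /eqP]; [left|right].
have {}cc : cycle h c by apply: sub_cycle cc => a b /and3P[].
(* The factor 4 in [(4 * k) ^ r] pays for the steps of 2: [4 ^ r >= 4] and [k ^ r >= 1]. *)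
have tc : 2 * k ^ r + 2 <= size c.
  apply: leq_trans sc; rewrite expnMn.
  have : 0 < k ^ r by rewrite expn_gt0 k0.
  have : 4 <= 4 ^ r by rewrite -{1}[4]expn1 leq_exp2l.
  by move: (4 ^ r) (k ^ r) => a b; clear; nia.
have [S [w [b0 [Q [n [[SW wS bS bw PQ] [QS fan]]]]]]] :=
  theta_fan sh hW lu lp lev_edge cc uc cW lc m1 m2 hm tc.
have L := two_linkedP sh hW conn uW vW uv SW wS bS bw PQ QS.
have [y [n0 [yS yw LP]]] := two_linked_upath sh uv L.
have [l0 fanP] := fan y yS yw.
exists (n0 + l0) => j jt; have [D [PD DS]] := fanP j jt.
by rewrite -addnA; apply: LP PD DS.
Qed.

Lemma avg_degree_vol (T : finType) (e : rel T) N : 0 < #|T| ->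
  (N%:R <= avg_degree e)%R -> N * #|T| <= vol e setT.
Proof.
move=> T0; have -> : vol e setT = \sum_v degree e v.
  rewrite vol_deg big_mkcond; apply: eq_bigr => v _; rewrite inE.
  by apply: eq_card => z; rewrite !inE.
by rewrite /avg_degree ler_pdivlMr ?ltr0n // -natrM ler_nat.
Qed.

Theorem theorem1 :
  exists c : rat, (0 < c)%R /\
  forall (k : nat) (T : finType) (e : rel T) (g : nat),
    simple_graph e -> ~ bipartite e -> two_connected e ->
    (c * k%:R <= avg_degree e)%R ->
    girth_is e g ->
    exists m : nat, odd m /\
      forall i : nat, i < k ^ ((g - 1) %/ 2) ->
        has_cycle_of_length e (m + 2 * i).
Proof.
(* Average degree [384 * k] means at least [384 * k * #|T|] ordered pairs; at least half of them are
   bichromatic, which is more than [2 * (96 * k) * #|T|.-1]. *)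
exists 384%:R%R; split=> [|k T e g [se ie] nbip [T3 conn]].
  by rewrite ltr0n.
have T0 : 0 < #|T| by rewrite ltnW // ltnW.
rewrite -natrM => /(avg_degree_vol T0) vole [[c0 [/andP[c03 _] sc0]] girth].
have g3 : 2 < g by rewrite -sc0.
set r := (g - 1) %/ 2.
have r0 : 0 < r by rewrite divn_gt0 // subn1 -ltnS prednK // ltnW // ltnW.
have rg : r.*2 < g.
  rewrite -muln2; apply: leq_ltn_trans (leq_trunc_div _ _) _.
  by rewrite subn1 prednK // ltnW // ltnW.
have {}girth s : is_cycle e s -> r.*2 < size s by move=> /girth; apply: leq_trans.
(* For [k = 0] no cycle is required, since [r > 0] makes [0 ^ r] vanish. *)
have [->|k0] := posnP k; first by exists 1; split=> // i; rewrite exp0n.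
have connE x y z : y != x -> z != x -> exists D n, upath e D y z n /\ x \notin D.
  move=> yx zx; apply: (connect_avoid _ yx (conn x y z yx zx)).
  by move=> a b /and3P[-> -> ->].
have [f volf] := half_bipartite ie.
set ef := [rel a b | e a b && (f a != f b)] in volf.
have sef : symmetric ef by move=> a b; rewrite /ef /= se eq_sym.
have [|W [volW connW]] := @two_connected_subgraph _ ef (96 * k) sef.
  move: volf vole T0; move: (vol e _) (vol ef _) #|T| => a b [|n] //=.
  by move: k0; clear; nia.
pose h := restr ef W.
have sh : symmetric h by move=> a b; apply/and3P/and3P => -[aW bW]; rewrite sef; split.
have hW a b : h a b -> (a \in W) && (b \in W) by case/and3P=> -> ->.
have he a b : h a b -> e a b by case/and3P=> _ _ /andP[].
have hf a b : h a b -> f a != f b by case/and3P=> _ _ /andP[].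
(* At most [#|W| * #|W|.-1] ordered pairs exist, so the density forces [#|W| > 192 * k]. *)
have W3 : 2 < #|W|.
  have : vol ef W <= #|W| * #|W|.-1.
    rewrite vol_deg -sum_nat_const; apply: leq_sum => x xW.
    have -> : #|W|.-1 = #|W :\ x| by rewrite (cardsD1 x W) xW.
    apply/subset_leq_card/subsetP => y; rewrite !inE => /andP[-> /andP[exy _]].
    by rewrite andbT; apply: contraTneq exy => ->; rewrite ie.
  move: volW k0; move: (vol ef W) #|W| => a b; case: b => [|[|[|]]] //=; clear; nia.
have volh : 192 * k * #|W|.-1 < vol h W.
  have -> : vol h W = vol ef W.
    by do 2!apply: eq_bigr => ? _; rewrite /h /restr /=; do 2!case: (_ \in W).
  by move: volW; rewrite (mulnA 2 96 k).
have [u0 [v0 [u0W v0W uv0]]] : exists u0 v0, [/\ u0 \in W, v0 \in W & u0 != v0].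
  by have /card_gt1P[u0 [v0 [? ? ?]]] := ltnW W3; exists u0, v0.
(* A path of [e] whose parity disagrees with the colouring [f]; [odd_ear] shortens it to one meeting
   [W] only in its ends. *)
have [D0 [n0 [P0 par0]]] := both_parities se ie T3 nbip connE (~~ (f u0 != f v0)) uv0.
have [|D' [u [v [n [[P uv uW vW par] DW]]]]] := odd_ear P0 u0W v0W (f := f).
  by rewrite par0; case: (f u0 != f v0).
have [l0 paths] := bipartite_upaths sh hW hf connW W3 k0 r0
  (fun s cs => girth s (ltac:(by case/andP: cs => ss /andP[cs us];
     rewrite /is_cycle ss /ucycleb us (sub_cycle he cs)))) volh uW vW uv.
have n_gt0 : 0 < n.
  by rewrite lt0n; apply: contra uv => /eqP E; move: P; rewrite E => P; inversion P.
have parl D l : upath h D u v l -> odd (n + l).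
  move=> Pl; rewrite oddD (upath_parity hf Pl).
  by move: par; case: (odd n); case: (f u != f v).
exists (n + l0); split.
  have [|D PD] := paths 0; first by rewrite expn_gt0 k0.
  by rewrite -[l0]addn0; apply: parl PD.
move=> i /paths[D PD]; rewrite -addnA.
apply: (upath_cycle P (upath_rev se (sub_upath he PD))) => //.
  move=> a aD' aD; apply: DW => //.
  exact: (subsetP (upath_sub hW PD uW)).
(* The total length is odd and both parts are positive, so it is at least 3. *)
have l_gt0 : 0 < l0 + 2 * i.
  by rewrite lt0n; apply: contra uv => /eqP E; move: PD; rewrite E => PD; inversion PD.
move: (parl _ _ PD) n_gt0 l_gt0; move: (_ + _ * _) => l; clear.
by case: n => [|[|n]] //; case: l => [|[|l]] //=; rewrite !addSn !addnS.
Qed.
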